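(* The sequence of standard preferential attachment trees $(T_n)_{n=1}^\infty$ has, as a sequence of unordered trees, the same distribution as the sequence of random split trees $(T_n^{\mathcal P})_{n=1}^\infty$ with $b=\infty$ and split vector $\mathcal P\sim\mathrm{GEM}(\tfrac12,\tfrac12)$; the same holds with $\mathcal P\sim\mathrm{PD}(\tfrac12,\tfrac12)$.
   Context: **Standard preferential attachment tree.** $T_1$ is a single root; $T_{n+1}$ is obtained from $T_n$ by adding one new node as a child of an existing node, where the parent is chosen to be $v$ with probability proportional to $d(v)+1$, with $d(v)$ the current outdegree (number of children) of $v$. (This is the linear preferential attachment tree $T_n^{\chi,\rho}$ with weights $w_k=\chi k+\rho$ for $\chi=\rho=1$.) **Random split tree** with $b=\infty$. Let $\mathcal T_\infty$ be the infinite rooted tree where every node has children labelled $1,2,3,\dots$. Let $\mathcal P=(P_i)_{i=1}^\infty$ be a random vector with $P_i\ge0$ and $\sum_i P_i=1$ (the split vector). Give each node $v$ of $\mathcal T_\infty$ an independent copy $\mathcal P^{(v)}=(P^{(v)}_i)_i$ of $\mathcal P$, chosen once and kept fixed. Each node holds at most one ball and is full if it holds one; initially all nodes are empty. Balls arrive one by one at the root and move instantaneously: (i) a ball arriving at an empty node stays there, making it full; (ii) a ball arriving at a full node $v$ continues to a child of $v$, child $i$ being chosen with probability $P_i^{(v)}$; given all vectors $\mathcal P^{(v)}$, all these choices are independent. $T_n^{\mathcal P}$ is the subtree of $\mathcal T_\infty$ consisting of the nodes that contain the first $n$ balls; all $T_n^{\mathcal P}$, $n\ge1$, are constructed from the same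 stream of balls. **Unordered trees.** Both sequences are increasing sequences of trees. Regarding them as sequences of unordered trees means ignoring the original labels of the children; equivalently, the children of each node are (re)labelled $1,2,3,\dots$ in order of appearance in both sequences. **Distributions.** $B(\alpha,\beta)$ for $\alpha,\beta>0$ is the Beta distribution on $[0,1]$ with density proportional to $x^{\alpha-1}(1-x)^{\beta-1}$. $\mathrm{GEM}(\alpha,\theta)$ is the distribution of the random probability vector $(P_i)_{i=1}^\infty$ given by $P_i=Z_i\prod_{j=1}^{i-1}(1-Z_j)$, where the $Z_j$ are independent with $Z_j\sim B(1-\alpha,\theta+j\alpha)$; here $(\alpha,\theta)=(\tfrac12,\tfrac12)$. $\mathrm{PD}(\alpha,\theta)$ is the distribution of the vector obtained by reordering $(P_i)_{i=1}^\infty\sim\mathrm{GEM}(\alpha,\theta)$ in decreasing order. *)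

(* Defs.v *)
From HB Require Import structures.
From mathcomp Require Import all_boot all_order all_algebra finmap.
From mathcomp Require Import all_classical all_reals all_analysis.

Set Implicit Arguments.
Unset Strict Implicit.
Unset Printing Implicit Defensive.

Import Order.TTheory GRing.Theory Num.Theory.
Import numFieldNormedType.Exports.

Local Open Scope classical_set_scope.
Local Open Scope ring_scope.

(** Indices are shifted by one everywhere: children, coordinates of split
    vectors, balls and members of a tree sequence are numbered 0, 1, 2, ...
    where the usual mathematical numbering is 1, 2, 3, ... *)

(* A node of the infinite tree is the word of child labels read from the root;
   [rcons v i] is the child of [v] with label [i]. *)
Definition node : Type := seq nat.
HB.instance Definition _ := Countable.copy node (seq nat).

Definition root : node := [::].

(* [parent root = root]; hence the test [u != root] in [children]. *)
Definition parent (v : node) : node := take (size v).-1 v.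

Definition tree : Type := {fset node}.
HB.instance Definition _ := Countable.copy tree {fset node}.
HB.instance Definition _ := isPointed.Build tree [fset root]%fset.
HB.instance Definition _ := @isMeasurable.Build default_measure_display
  tree discrete_measurable discrete_measurable0
  discrete_measurableC discrete_measurableU.

Definition children (t : tree) (v : node) : tree :=
  [fset u in t | (u != root) && (parent u == v)]%fset.

Definition outdegree (t : tree) (v : node) : nat := #|` children t v|%fset.

Definition add_child (t t' : tree) (v : node) : Prop :=
  exists2 i, rcons v i \notin t & t' = (rcons v i |` t)%fset.

(* The number of siblings of [w] in [t n] that entered the sequence before [w]. *)
Definition birth_rank (t : nat -> tree) (n : nat) (w : node) : nat :=
  #|` [fset u in children (t n) (parent w) |
        has (fun m => (u \in t m) && (w \notin t m)) (iota 0 n.+1)]|%fset.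

Definition relabel (t : nat -> tree) (n : nat) (w : node) : node :=
  mkseq (fun k => birth_rank t n (take k.+1 w)) (size w).

(* An increasing sequence of trees as a sequence of unordered trees: the
   children of each node are relabelled in order of appearance. *)
Definition unordered (t : nat -> tree) : nat -> tree :=
  fun n => [fset relabel t n w | w in t n]%fset.

Definition cylinders d (E : measurableType d) : set (set (nat -> E)) :=
  \bigcup_n preimage_set_system setT (fun x : nat -> E => x n) measurable.

Notation seq_space E := (g_sigma_algebraType (@cylinders _ E)).

Definition eq_law d (E : measurableType d) (R : realType)
    (mu nu : set E -> \bar R) : Prop :=
  forall A, measurable A -> mu A = nu A.

Definition mutually_independent (R : realType) d (Om : measurableType d)
    (P : probability Om R) d' (E : measurableType d') (I : eqType)
    (X : I -> {RV P >-> E}) : Prop :=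
  forall (s : seq I) (B : I -> set E),
    uniq s -> (forall i, measurable (B i)) ->
    P (\bigcap_(i in [set` s]) X i @^-1` B i) =
    (\prod_(i <- s) fine (P (X i @^-1` B i)))%:E.

Definition generated_sigma d (Om : measurableType d) d' (E : measurableType d')
    (I : Type) (X : I -> Om -> E) : set (set Om) :=
  <<s \bigcup_i preimage_set_system setT (X i) measurable >>.

(* [Y] is a version of the conditional probability of [A] given the
   sub-sigma-algebra [G]. *)
Definition is_cond_prob (R : realType) d (Om : measurableType d)
    (P : probability Om R) (G : set (set Om)) (A : set Om) (Y : Om -> R) : Prop :=
  (forall B : set R, measurable B -> G (Y @^-1` B)) /\
  (forall D, G D -> P (D `&` A) = (\int[P]_(w in D) (Y w)%:E)%E).

Definition is_beta (R : realType) (a b : R) (mu : set R -> \bar R) : Prop :=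
  exists c : R, forall B : set R, measurable B ->
    mu B = (\int[lebesgue_measure]_(x in B `&` `[0%R, 1%R])
             (c * (x `^ (a - 1) * (1 - x) `^ (b - 1)))%:E)%E.

Definition stick_breaking (R : realType) (z : nat -> R) : nat -> R :=
  fun i => z i * \prod_(j < i) (1 - z j).

(* [j.+1%:R]: the factors are Z_{j+1} ~ B(1 - alpha, theta + (j+1) alpha). *)
Definition is_GEM (R : realType) (alpha theta : R)
    (mu : set (seq_space R) -> \bar R) : Prop :=
  exists d (Om : measurableType d) (P : probability Om R)
         (Z : nat -> {RV P >-> R}),
  [/\ mutually_independent Z,
      forall j, is_beta (1 - alpha) (theta + j.+1%:R * alpha)
                  (distribution P (Z j))
    & eq_law mu
        (pushforward P (fun w => stick_breaking (fun j => Z j w) : seq_space R))].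

Definition decreasing_reordering (R : realType) (p q : nat -> R) : Prop :=
  (forall m n, (m <= n)%N -> q n <= q m) /\
  exists2 s : nat -> nat, bijective s & q = p \o s.

Definition is_PD (R : realType) (alpha theta : R)
    (mu : set (seq_space R) -> \bar R) : Prop :=
  exists d (Om : measurableType d) (P : probability Om R)
         (X X' : {RV P >-> seq_space R}),
  [/\ is_GEM alpha theta (distribution P X),
      {ae P, forall w, decreasing_reordering (X w) (X' w)}
    & eq_law mu (distribution P X')].

(* The label of the new child is left free, as only the unordered tree
   matters; the history conditioned upon is that of the labelled trees. *)
Definition preferential_attachment (R : realType) d (Om : measurableType d)
    (P : probability Om R) (T : {RV P >-> seq_space tree}) : Prop :=
  (forall w, T w 0%N = [fset root]%fset) /\
  (forall (n : nat) (t : nat -> tree) (v : node), v \in t n ->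
     P [set w | (forall m, (m <= n)%N -> T w m = t m) /\
                add_child (t n) (T w n.+1) v] =
     (P [set w | forall m, (m <= n)%N -> T w m = t m] *
      ((outdegree (t n) v).+1%:R /
       \sum_(u <- t n) (outdegree (t n) u).+1%:R)%:E)%E).

(* [c v] is the child label chosen at [v] if [v] is full.  The nodes visited
   are distinct, so an empty node is reached within [#|` t|] steps. *)
Definition ball_position (c : node -> nat) (t : tree) : node :=
  iter #|` t|%fset (fun v => if v \in t then rcons v (c v) else v) root.

(* The full nodes after [n] balls, [c (k, v)] being the choice made by ball [k]
   on arriving at [v] when [v] is full. *)
Fixpoint full_nodes (c : nat * node -> nat) (n : nat) : tree :=
  if n is k.+1 then
    let t := full_nodes c k in
    (ball_position (fun v => c (k, v)) t |` t)%fset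
  else fset0.

(* The first tree of the sequence contains one ball. *)
Definition split_tree (c : nat * node -> nat) : nat -> tree :=
  fun n => full_nodes c n.+1.

(* [V v] is the vector attached to [v]; the family [V] is i.i.d. with law [mu].
   The last clause says that, given all the vectors, the choices [C k] are
   independent, the choice at [v] being [i] with probability [V v i].  As the
   choices take values in [nat], it forces the vectors to be almost surely
   nonnegative with sum one. *)
Definition split_tree_model (R : realType) (mu : probability (seq_space R) R)
    d (Om : measurableType d) (P : probability Om R)
    (V : node -> {RV P >-> seq_space R})
    (C : nat * node -> {RV P >-> nat}) : Prop :=
  [/\ forall v, eq_law (distribution P (V v)) mu,
      mutually_independent V
    & forall (s : seq (nat * node)) (i : nat * node -> nat), uniq s ->
        is_cond_prob P (generated_sigma V)
          (\bigcap_(k in [set` s]) C k @^-1` [set i k])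
          (fun w => \prod_(k <- s) V k.2 w (i k))].

(* Main.v *)
(** The labels of a split tree are forgotten by summing over all injective
    choices of labels, node by node: the probability that the unordered split
    tree follows a given history factorizes over the nodes [v] of that history
    into [E (sum over distinct j_1, ..., j_k of prod_i P_(j_i) ^ n_i)], where
    [n_1, ..., n_k] are the sizes of the subtrees at the children of [v].  For
    GEM(a, t) this is Pitman's exchangeable partition probability function,
    obtained by conditioning on the first stick.  For [a = t = 1/2] the product
    over the nodes telescopes to [prod_v d(v)! / (1 * 3 * ... * (2n - 1))],
    which is also the product of the transition probabilities
    [(d(v) + 1) / (2n + 1)] of preferential attachment.

    Both laws have total mass one and there are finitely many histories of each
    length, so an upper bound for the split tree and a lower bound for
    preferential attachment suffice.  The sums above then need only be bounded
    over finitely many labels, uniformly in their number, and rearranging the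
    coordinates in decreasing order does not affect such a bound: this covers
    PD(a, t). *)

From HB Require Import structures.
Require Import Defs.
From mathcomp Require Import all_boot all_order all_algebra finmap.
From mathcomp Require Import all_classical all_reals all_analysis.
From mathcomp Require Import measurable_realfun.
From mathcomp Require Import ring lra.

Set Implicit Arguments.
Unset Strict Implicit.
Unset Printing Implicit Defensive.

Import Order.TTheory GRing.Theory Num.Theory.
Import numFieldNormedType.Exports.

Local Open Scope classical_set_scope.
Local Open Scope ring_scope.

(** * Integration and independence *)

(** Let n_x be the size of the subtree at x. The factor of a node v has [rising t (n_v - 1)] in the
    denominator and, for each child c, [rising (1 - a) (n_c - 1)] in the numerator. The telescoping
    thus rests on [1 - a = t], while [a = t] turns the product of the [t + i a] into a power of [a]
    times d(v)!, the product of the attachment weights 1, ..., d(v). Both relations together single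
    out 1/2. The exponent of a coordinate is a subtree size because every ball that ends in the
    subtree at c crosses the edge to c once. One-sided bounds fit both models: finitely many labels
    exhaust the split tree only in the limit, and the free label of a new child in preferential
    attachment makes an inclusion of events the natural statement. No mass escapes, since every
    outcome of the split tree follows some canonical history. Independence is given for finitely
    many events only; expectations of products are reached by trading one indicator at a time for a
    function. *)

Section change_of_density.
Import HBNNSimple.
Local Open Scope ereal_scope.
Context d1 d2 (T : measurableType d1) (E : measurableType d2) (R : realType).
Variables (P : {measure set T -> \bar R}) (nu : {measure set E -> \bar R}).
Variables (phi : T -> E) (H : T -> R).
Hypothesis mphi : measurable_fun [set: T] phi.
Hypothesis mH : measurable_fun [set: T] H.
Hypothesis H0 : forall x, (0 <= H x)%R.
Hypothesis nuE : forall B, measurable B -> nu B = \int[P]_(x in phi @^-1` B) (H x)%:E.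

Let integral_density_nnsfun (h : {nnsfun E >-> R}) :
  \int[nu]_x (h x)%:E = \int[P]_x ((h (phi x))%:E * (H x)%:E).
Proof.
rewrite integralT_nnsfun sintegralE.
have mA r : measurable (phi @^-1` (h @^-1` [set r])).
  by rewrite -[X in measurable X]setTI; apply: mphi.
pose F r x : \bar R :=
  r%:E * ((H x)%:E * (\1_(phi @^-1` (h @^-1` [set r])) x)%:E).
have hE x : (h (phi x))%:E * (H x)%:E =
    \sum_(r \in range h) F r x.
  rewrite (fimfunE h (phi x)) -fsumEFin//.
  rewrite ge0_mule_fsuml; last first.
    move=> r; rewrite lee_fin; have [/set_mem [y _ <-]|hr] := boolP (r \in range h).
      by rewrite mulr_ge0// indicE.
    rewrite indicE memNset ?mulr0// => hx; move/negP: hr; apply.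
    by rewrite inE; exists (phi x).
  by apply: eq_fsbigr => r _; rewrite EFinM -muleA [in LHS](muleC _ (H x)%:E).
under [RHS]eq_integral do rewrite hE.
have mF r : measurable_fun [set: T] (F r).
  apply: measurable_funeM; apply: emeasurable_funM; first exact/measurable_EFinP.
  exact/measurable_EFinP/measurable_indic.
rewrite ge0_integral_fsum//; last first.
  move=> r x _; rewrite /F -!EFinM lee_fin mulrCA mulr_ge0//.
  have [/set_mem [y _ <-]|hr] := boolP (r \in range h).
    by idtac; rewrite mulr_ge0// indicE.
  rewrite indicE memNset ?mulr0// => hx; move/negP: hr; apply.
  by rewrite inE; exists (phi x).
apply: eq_fsbigr => r /set_mem [y _ <-].
rewrite ge0_integralZl ?lee_fin//; last first.
- by move=> x _; rewrite -EFinM lee_fin mulr_ge0// indicE.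
- apply: emeasurable_funM; first exact/measurable_EFinP.
  exact/measurable_EFinP/measurable_indic.
rewrite nuE//; congr (_ * _).
by rewrite integral_mkcond epatch_indic.
Qed.

(** From simple functions by monotone convergence. With [phi] a random variable and [H] the product
    of the other factors, it trades an indicator for a function in an independent product; with
    [phi = id] it integrates against a beta law. *)
Lemma integral_density (f : E -> \bar R) : measurable_fun [set: E] f ->
  (forall x, 0 <= f x) -> \int[nu]_x f x = \int[P]_x (f (phi x) * (H x)%:E).
Proof.
move=> mf f0; pose g := nnsfun_approx measurableT mf.
have nd x : {homo (fun n => (g n x)%:E) : n m / (n <= m)%N >-> n <= m}.
  by move=> n m nm; rewrite lee_fin; exact/lefP/nd_nnsfun_approx.
have gf x : (fun n => (g n x)%:E) @ \oo --> f x.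
  by apply: cvg_nnsfun_approx => // y _; exact: f0.
have -> : \int[nu]_x f x = limn (fun n => \int[nu]_x (g n x)%:E).
  rewrite -monotone_convergence//.
  - by apply: eq_integral => x _; apply/esym/cvg_lim => //; exact: gf.
  - by move=> n; exact/measurable_EFinP.
  - by move=> n x _; rewrite lee_fin.
under eq_fun do rewrite integral_density_nnsfun.
rewrite -monotone_convergence//.
- apply: eq_integral => x _; apply/cvg_lim => //.
  by apply: cvgeZr.
- move=> n; apply: emeasurable_funM; apply/measurable_EFinP => //.
  exact: measurableT_comp.
- by move=> n x _; rewrite -EFinM lee_fin mulr_ge0.
- move=> x _ n m nm; rewrite lee_wpmul2r ?lee_fin//; exact: nd.
Qed.

End change_of_density.

Section independent_product.
Context (R : realType) d (Om : measurableType d) (P : probability Om R).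
Context d' (E : measurableType d') (I : eqType) (X : I -> {RV P >-> E}).
Hypothesis indepX : mutually_independent X.
Variables (f : I -> E -> R) (c : I -> R).
Hypothesis mf : forall i, measurable_fun [set: E] (f i).
Hypothesis f0 : forall i x, 0 <= f i x.

Let mXB i B : measurable B -> measurable (X i @^-1` B).
Proof. by move=> mB; rewrite -[Y in measurable Y]setTI; exact: measurable_funPT. Qed.

(** Functions on [s1], indicators on [s2]. In the induction the head [i] of [s1] moves to [s2] with
    an arbitrary event; the hypothesis then says that the image under [X i] of the measure with
    density [H], the product of the other factors, is a multiple of the law of [X i]. *)
Let integral_prod_indic (s1 s2 : seq I) (B : I -> set E) :
  uniq (s1 ++ s2) -> (forall i, measurable (B i)) ->
  (forall i, i \in s1 -> \int[P]_w (f i (X i w))%:E = (c i)%:E)%E ->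
  (\int[P]_w (\prod_(i <- s1) f i (X i w) *
              \prod_(i <- s2) \1_(B i) (X i w))%:E =
   (\prod_(i <- s1) c i * \prod_(i <- s2) fine (P (X i @^-1` B i)))%:E)%E.
Proof.
elim: s1 s2 B => [|i s1 IH] s2 B us mB cE.
  rewrite big_nil mul1r -indepX//.
  have mBs : measurable (\bigcap_(i in [set` s2]) X i @^-1` B i).
    by apply: fin_bigcap_measurable => // i _; exact: mXB.
  rewrite -(setIT (\bigcap_(i in _) _)) -integral_indic//.
  apply: eq_integral => w _; congr EFin; rewrite big_nil mul1r.
  rewrite indicE; have [/set_mem wB|wB] := boolP (w \in _).
    by rewrite big_seq big1// => i si; rewrite indicE mem_set//; apply: wB.
  have : ~ forall i, i \in s2 -> B i (X i w).
    by move=> H; move/negP: wB; apply; rewrite inE => i /= /H.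
  move=> /existsNP[i /not_implyP[si Bi]].
  by rewrite (big_rem i)//= indicE memNset// mul0r.
have /andP[i1 us1] : (i \notin s1 ++ s2) && uniq (s1 ++ s2) by [].
have is2 : i \notin s2 by move: i1; rewrite mem_cat negb_or => /andP[].
pose k := \prod_(i <- s1) c i * \prod_(i <- s2) fine (P (X i @^-1` B i)).
have cE1 j : j \in s1 -> (\int[P]_w (f j (X j w))%:E = (c j)%:E)%E.
  by move=> js; apply: cE; rewrite inE js orbT.
have k0 : 0 <= k.
  apply: mulr_ge0; last by apply: prodr_ge0 => j _; exact: fine_ge0.
  rewrite big_seq; apply: prodr_ge0 => j js.
  by rewrite -lee_fin -cE1// integral_ge0// => w _; rewrite lee_fin.
rewrite [X in _ = (X * _)%:E]big_cons -mulrA -/k.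
pose H w := \prod_(i <- s1) f i (X i w) * \prod_(i <- s2) \1_(B i) (X i w).
have H0 w : 0 <= H w.
  by apply: mulr_ge0; apply: prodr_ge0 => j _ //; rewrite indicE.
have mH : measurable_fun [set: Om] H.
  apply: measurable_funM; apply: measurable_prod => j _.
    exact: measurableT_comp.
  apply: (measurableT_comp (f := \1_(B j) : E -> R)) => //.
pose nu := mscale (NngNum k0) (distribution P (X i)).
have : (\int[nu]_x (f i x)%:E = \int[P]_w ((f i (X i w))%:E * (H w)%:E))%E.
  apply: integral_density => //; last 2 first.
  - exact/measurable_EFinP.
  - by move=> x; rewrite lee_fin.
  move=> A mA; rewrite /nu /mscale /=.
  pose B' j := if j == i then A else B j.
  have mB' j : measurable (B' j) by rewrite /B'; case: ifP.
  rewrite integral_mkcond.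
  have us' : uniq (s1 ++ i :: s2).
    by rewrite -(perm_uniq (permEl (perm_catCA [:: i] s1 s2))).
  transitivity (\int[P]_w (\prod_(j <- s1) f j (X j w) *
              \prod_(j <- i :: s2) \1_(B' j) (X j w))%:E)%E; last first.
    apply: eq_integral => w _; rewrite patchE.
    rewrite big_cons mulrCA {1}/B' eqxx indicE.
    have -> : \prod_(j <- s2) \1_(B' j) (X j w) = \prod_(j <- s2) \1_(B j) (X j w) :> R.
      apply: eq_big_seq => j js; rewrite /B'; case: eqP => // ji.
      by rewrite ji (negPf is2) in js.
    rewrite -/(H w) (_ : (w \in X i @^-1` A) = (X i w \in A)); last first.
      by apply/idP/idP; rewrite !inE.
    by case: ifP => _; rewrite ?mul1r ?mul0r.
  rewrite IH// big_cons {1}/B' eqxx.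
  have -> : \prod_(j <- s2) fine (P (X j @^-1` B' j)) =
            \prod_(j <- s2) fine (P (X j @^-1` B j)).
    apply: eq_big_seq => j js; rewrite /B'; case: eqP => // ji.
    by rewrite ji (negPf is2) in js.
  rewrite mulrCA mulrC EFinM fineK//; first by rewrite fin_num_measure//; exact: mXB.
rewrite ge0_integral_mscale//=; last 2 first.
- exact/measurable_EFinP.
- by move=> x _; rewrite lee_fin.
rewrite ge0_integral_distribution//; last 2 first.
- exact/measurable_EFinP.
- by move=> x; rewrite lee_fin.
rewrite [X in (_ * X)%E](cE i) ?mem_head// -EFinM mulrC => ->.
by apply: eq_integral => w _; rewrite big_cons -EFinM -mulrA.
Qed.

Lemma integral_prod_independent (s : seq I) : uniq s ->
  (forall i, i \in s -> \int[P]_w (f i (X i w))%:E = (c i)%:E)%E ->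
  (\int[P]_w (\prod_(i <- s) f i (X i w))%:E = (\prod_(i <- s) c i)%:E)%E.
Proof.
move=> us cE; have := @integral_prod_indic s [::] (fun=> setT).
rewrite cats0 big_nil mulr1 => <-//.
by apply: eq_integral => w _; rewrite big_nil mulr1.
Qed.

End independent_product.

(** * Moments of the beta distribution *)

Lemma powR_sub1M (R : realType) (p x : R) : 0 < x -> x `^ p = x `^ (p - 1) * x.
Proof.
by move=> x0; rewrite -{3}(powRr1 (ltW x0)) -powRD ?subrK// (gt_eqF x0) implybT.
Qed.

Section beta_moments.
Context (R : realType).
Implicit Types p q x : R.

Definition beta_density p q x : R := x `^ (p - 1) * (1 - x) `^ (q - 1).

Definition beta_integral p q : \bar R :=
  (\int[lebesgue_measure]_(x in `]0%R, 1%R[) (beta_density p q x)%:E)%E.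

Lemma measurable_beta_density p q : measurable_fun [set: R] (beta_density p q).
Proof.
apply: measurable_funM; first exact: measurable_powR.
apply: (measurableT_comp (f := fun y : R => y `^ (q - 1))).
  exact: measurable_powR.
exact: measurable_funB.
Qed.

Lemma beta_density_ge0 p q x : 0 <= beta_density p q x.
Proof. by rewrite mulr_ge0// powR_ge0. Qed.

(** Multiply the density by x + (1 - x) = 1. *)
Lemma beta_integralD p q :
  (beta_integral p q = beta_integral (p + 1) q + beta_integral p (q + 1))%E.
Proof.
rewrite /beta_integral -ge0_integralD//=; last 4 first.
- by move=> x _; rewrite lee_fin beta_density_ge0.
- by apply/measurable_EFinP; apply: measurable_funTS; exact: measurable_beta_density.
- by move=> x _; rewrite lee_fin beta_density_ge0.
- by apply/measurable_EFinP; apply: measurable_funTS; exact: measurable_beta_density.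
apply: eq_integral => x; rewrite inE/= in_itv/= => /andP[x0 x1].
rewrite -EFinD; congr EFin; rewrite /beta_density !addrK.
rewrite (powR_sub1M p x0) (@powR_sub1M _ q (1 - x)) ?subr_gt0//.
by ring.
Qed.

(* Integration by parts is done on [[e n, 1 - e n]], away from the
   singularities of the density at 0 and 1. *)
Let e n : R := n.+3%:R^-1.
Let e0 n : 0 < e n. Proof. by rewrite invr_gt0. Qed.
Let e1 n : e n < 1 - e n.
Proof.
by rewrite ltrBrDr -mulr2n -mulr_natl ltr_pdivrMr ?mul1r ?ltr_nat.
Qed.

Let is_derive_F p q x : 0 < x < 1 ->
  is_derive x 1 (fun x => x `^ p * (1 - x) `^ q)
  (p * beta_density p (q + 1) x - q * beta_density (p + 1) q x).
Proof.
move=> /andP[x0 x1]; have y0 : 0 < 1 - x by rewrite subr_gt0.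
have Dy : is_derive x 1 (fun x : R => 1 - x) (- 1).
  have -> : (fun x : R => 1 - x) = cst 1 \- id by [].
  by rewrite -[- 1]add0r; exact: is_deriveB.
have Dq := is_derive1_powR q y0.
have Dp := is_derive1_powR p x0.
have Dc : is_derive x 1 (fun x : R => (1 - x) `^ q) (q * (1 - x) `^ (q - 1) * - 1).
  exact: (@is_derive1_comp _ (fun y : R => y `^ q) (fun x : R => 1 - x) x _ _ Dq Dy).
apply: is_derive_eq (is_deriveM Dp Dc) _; rewrite /beta_density !addrK /=.
rewrite /GRing.scale /=; ring.
Qed.

Let in01 n x : x \in `[e n, 1 - e n] -> 0 < x < 1.
Proof.
rewrite in_itv/= => /andP[x1 x2]; rewrite (lt_le_trans (e0 n) x1)/=.
by rewrite (le_lt_trans x2)// ltrBlDr ltrDl.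
Qed.

Let continuous_beta_density p q x :
  0 < x < 1 -> {for x, continuous (beta_density p q)}.
Proof.
by move=> /(@is_derive_F (p - 1) (q - 1))[/derivable1_diffP/differentiable_continuous].
Qed.

Let integrable_beta_density p q n :
  lebesgue_measure.-integrable `[e n, 1 - e n] (EFin \o beta_density p q).
Proof.
apply: continuous_compact_integrable; first exact: segment_compact.
apply: continuous_in_subspaceT => x /set_mem /in01.
exact: continuous_beta_density.
Qed.

Let F p q x : R := x `^ p * (1 - x) `^ q.

(** The fundamental theorem for [F p q], written without a difference of integrals so that it passes
    to limits not known to be finite. *)
Let FTC p q n :
  (p%:E * (\int[lebesgue_measure]_(x in `[e n, (1 - e n)%R])
            (beta_density p (q + 1) x)%:E) =
   q%:E * (\int[lebesgue_measure]_(x in `[e n, (1 - e n)%R])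
            (beta_density (p + 1) q x)%:E)
   + (F p q (1 - e n) - F p q (e n))%:E)%E.
Proof.
have cF x : 0 < x < 1 -> {for x, continuous (F p q)}.
  by move=> /(@is_derive_F p q)[+ _] => /derivable1_diffP/differentiable_continuous.
pose f x := p * beta_density p (q + 1) x - q * beta_density (p + 1) q x.
have : (\int[lebesgue_measure]_(x in `[e n, (1 - e n)%R]) (f x)%:E =
    (F p q (1 - e n))%:E - (F p q (e n))%:E)%E.
  apply: continuous_FTC2 => //.
  - apply: continuous_in_subspaceT => x /set_mem /in01 x01.
    apply: cvgB; apply: cvgM; try exact: cvg_cst; exact: continuous_beta_density.
  - split.
    + move=> x xe; have /in01 : x \in `[e n, 1 - e n].
        by apply: subset_itv_oo_cc xe.
      by move=> /(@is_derive_F p q)[].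
    + apply: cvg_at_right_filter; apply: cF.
      by apply: (@in01 n); rewrite in_itv/= lexx ltW.
    + apply: cvg_at_left_filter; apply: cF.
      by apply: (@in01 n); rewrite in_itv/= lexx ltW.
  - move=> x xe; have /in01 : x \in `[e n, 1 - e n].
      by apply: subset_itv_oo_cc xe.
    by rewrite derive1E => /(@is_derive_F p q)[_ ->].
under eq_integral do rewrite EFinB !EFinM.
rewrite integralB//=; last 2 first.
- by apply: integrableZl => //; exact: integrable_beta_density.
- by apply: integrableZl => //; exact: integrable_beta_density.
rewrite !integralZl//; last 2 first.
- exact: integrable_beta_density.
- exact: integrable_beta_density.
have fin a b : ((\int[lebesgue_measure]_(x in `[e n, (1 - e n)%R]) (beta_density a b x)%:E)
    \is a fin_num)%E.
  by apply: integrable_fin_num => //; exact: integrable_beta_density.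
move: (fin p (q + 1)) (fin (p + 1) q).
move=> /fineK <- /fineK <-; rewrite -!EFinM -!EFinB -EFinD => -[] H.
by congr EFin; rewrite -H; ring.
Qed.

Let cvg_e : e n @[n --> \oo] --> (0 : R).
Proof.
have := @cvg_harmonic R; rewrite -(cvg_shiftn 2).
by under eq_fun do rewrite addn2.
Qed.

Let cvg_e_powR p : 0 < p -> (e n) `^ p @[n --> \oo] --> (0 : R).
Proof.
by move=> p0; have /cvg_at_rightP := powR_cvg0 p0; apply; split.
Qed.

Let F_cvg p q : 0 < p -> 0 < q ->
  F p q (1 - e n) - F p q (e n) @[n --> \oo] --> (0 : R).
Proof.
move=> p0 q0; rewrite -[X in _ --> X](subrr 0).
have e1_1 n : e n <= 1.
  by rewrite (le_trans (ltW (e1 n)))// gerDl oppr_le0 ltW.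
have powR_le1 r x : 0 < r -> 0 <= x <= 1 -> x `^ r <= 1.
  move=> r0 /andP[x0 x1]; rewrite -[leRHS](@powRr0 _ 1) -[X in _ <= X](_ : 1 `^ r = _).
    by apply: ge0_ler_powR => //; rewrite ?nnegrE ?ltW.
  by rewrite !powR1.
apply: cvgB.
- apply: (@squeeze_cvgr _ _ _ _ (fun=> 0) (fun n => e n `^ q)); last 2 first.
  + exact: cvg_cst.
  + exact: cvg_e_powR.
  apply: nearW => n; rewrite /F subKr mulr_ge0 ?powR_ge0//=.
  rewrite -[leRHS]mul1r ler_wpM2r ?powR_ge0// powR_le1//.
  by rewrite subr_ge0 e1_1 gerDl oppr_le0 ltW.
- apply: (@squeeze_cvgr _ _ _ _ (fun=> 0) (fun n => e n `^ p)); last 2 first.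
  + exact: cvg_cst.
  + exact: cvg_e_powR.
  apply: nearW => n; rewrite /F mulr_ge0 ?powR_ge0//=.
  rewrite -[leRHS]mulr1 ler_wpM2l ?powR_ge0// powR_le1//.
  by rewrite subr_ge0 e1_1 gerDl oppr_le0 ltW.
Qed.

Let J_cvg p q : (\int[lebesgue_measure]_(x in `[e n, (1 - e n)%R])
    (beta_density p q x)%:E @[n --> \oo] --> beta_integral p q)%E.
Proof.
rewrite /beta_integral (_ : `]0, 1[%classic = \bigcup_n `[e n, 1 - e n]%classic).
  apply: ge0_nondecreasing_set_cvg_integral => //.
  - apply/nondecreasing_seqP => n; rewrite subsetEset.
    have en : e n.+1 <= e n by rewrite lef_pV2 ?posrE// ler_nat.
    by apply: subset_itv; rewrite bnd_simp// lerD2l lerN2.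
  - move=> n; apply/measurable_EFinP; apply: measurable_funTS.
    exact: measurable_beta_density.
  - by move=> n x _; rewrite lee_fin beta_density_ge0.
apply/seteqP; split=> x /=; last by move=> [n _ /in01]; rewrite in_itv.
rewrite in_itv/= => /andP[x0 x1].
have y0 : 0 < 1 - x by rewrite subr_gt0.
have [n _ en] : \forall n \near \oo, e n < x /\ e n < 1 - x.
  near=> n; split; near: n; exact: (cvgr_lt _ cvg_e).
exists n => //=; have [ex ey] := en n (leqnn n).
by rewrite in_itv/= ltW// lerBrDr -lerBrDl ltW.
Unshelve. all: by end_near. Qed.

Lemma beta_integral_parts p q : 0 < p -> 0 < q ->
  (p%:E * beta_integral p (q + 1) = q%:E * beta_integral (p + 1) q)%E.
Proof.
move=> p0 q0.
have H1 := cvgeZl (y := p%:E) isT (@J_cvg p (q + 1)).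
have H2 := cvgeZl (y := q%:E) isT (@J_cvg (p + 1) q).
have H3 : ((F p q (1 - e n) - F p q (e n))%:E @[n --> \oo] --> 0%E)%E.
  by apply: cvg_EFin; [exact: nearW | exact: F_cvg].
have H4 := cvgeD _ H2 H3; rewrite adde0 in H4.
move: H1; under eq_fun do rewrite FTC.
by move/(cvg_unique (@ereal_hausdorff R)); apply; apply: H4; rewrite fin_num_adde_defl.
Qed.

End beta_moments.

Definition rising (R : realType) (x : R) (n : nat) : R := \prod_(r < n) (x + r%:R).

Section beta_random_variable.
Context (R : realType) d (Om : measurableType d) (P : probability Om R).
Variables (Z : {RV P >-> R}) (p q : R).
Hypotheses (p0 : 0 < p) (q0 : 0 < q) (Zbeta : is_beta p q (distribution P Z)).

(** [is_beta] fixes neither the sign nor the value of the constant. A negative one would give a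
    nonpositive total mass; the value is settled later by the total mass one, through [moment00]. *)
Let beta_constant : exists2 c : R, 0 <= c & forall f : R -> R,
  measurable_fun [set: R] f -> (forall x, 0 <= f x) ->
  (\int[P]_w (f (Z w))%:E =
   c%:E * \int[lebesgue_measure]_(x in `]0%R, 1%R[) (f x * beta_density p q x)%:E)%E.
Proof.
have [c cE0] := Zbeta.
have cE B : measurable B -> distribution P Z B =
    (\int[lebesgue_measure]_(x in B `&` `[0%R, 1%R])
       (c * beta_density p q x)%:E)%E by exact: cE0.
have mb := @measurable_beta_density R p q.
have b0 := @beta_density_ge0 R p q.
have c0 : 0 <= c.
  rewrite leNgt; apply/negP => c0; have := cE _ measurableT.
  rewrite [X in X = _]probability_setT setTI.
  move=> I1; have := @lte01 R; rewrite [X in (_ < X)%E]I1 ltNge => /negP; apply.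
  have c0' x : (0%E <= (- c * beta_density p q x)%:E)%E.
    by rewrite lee_fin mulr_ge0 ?b0// oppr_ge0 ltW.
  have -> : (\int[lebesgue_measure]_(x in `[0%R, 1%R])
      (c * beta_density p q x)%:E =
      - \int[lebesgue_measure]_(x in `[0%R, 1%R]) (- c * beta_density p q x)%:E)%E.
    rewrite -integral_ge0N//; apply: eq_integral => x _.
    by rewrite -EFinN mulNr opprK.
  by rewrite oppe_le0 integral_ge0.
exists c => // f mf f0.
pose I01 := `[0%R, 1%R]%classic : set R.
pose H x : R := \1_I01 x * (c * beta_density p q x).
have mH : measurable_fun [set: R] H.
  apply: measurable_funM; first by apply: measurable_indic; exact: measurable_itv.
  exact: (measurable_funM (f := cst c)).
have H0 x : 0 <= H x by rewrite /H indicE mulr_ge0 ?ler0n// mulr_ge0 ?b0.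
have <- := @ge0_integral_distribution _ _ _ _ _ P Z (EFin \o f) _ _; last 2 first.
- exact/measurable_EFinP.
- by move=> x; rewrite lee_fin.
have HE (g : R -> R) x : (((fun x => (g x * (c * beta_density p q x))%:E) \_ I01) x =
   (g x * H x)%:E)%E.
  by rewrite patchE /H indicE; case: ifP => _; rewrite ?mul1r ?mul0r ?mulr0.
rewrite (@integral_density _ _ _ _ _ lebesgue_measure (distribution P Z) id H)//; last 2 first.
- move=> B mB; apply: etrans (cE B mB) _.
  rewrite preimage_id integral_mkcondr.
  apply: eq_integral => x _; have := HE (cst 1) x; rewrite mul1r => <-.
  by rewrite !patchE mul1r.
- exact/measurable_EFinP.
under eq_integral do rewrite -EFinM -HE.
rewrite -integral_mkcond /I01 integral_itv_bndoo//; last first.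
  apply/measurable_EFinP; apply: measurable_funTS.
  by apply: measurable_funM => //; exact: (measurable_funM (f := cst c)).
rewrite -ge0_integralZl_EFin//; last 2 first.
- by move=> x _; rewrite lee_fin mulr_ge0.
- by apply/measurable_EFinP; apply: measurable_funTS; exact: measurable_funM.
by apply: eq_integral => x _; rewrite -EFinM mulrCA.
Qed.

Let moment a b : \bar R := (\int[P]_w (`|Z w| ^+ a * `|1 - Z w| ^+ b)%:E)%E.

Let momentE : exists2 c : R, 0 <= c & forall a b,
  (moment a b = c%:E * beta_integral (p + a%:R) (q + b%:R))%E.
Proof.
have [c c0 cE] := beta_constant; exists c => // a b.
rewrite /moment (cE (fun x => `|x| ^+ a * `|1 - x| ^+ b)); last 2 first.
- apply: measurable_funM; apply: measurable_funX.
    exact: normr_measurable.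
  apply: measurableT_comp; first exact: normr_measurable.
  exact: measurable_funB.
- by move=> x; rewrite mulr_ge0// exprn_ge0.
congr (_ * _)%E; apply: eq_integral => x; rewrite inE/= in_itv/= => /andP[x0 x1].
have y0 : 0 < 1 - x by rewrite subr_gt0.
have pw r n y : 0 < y -> y `^ (r + n%:R - 1) = y ^+ n * y `^ (r - 1) :> R.
  move=> yp; rewrite addrAC powRD ?powR_mulrn 1?mulrC ?ltW//.
  by rewrite (gt_eqF yp) implybT.
by rewrite /beta_density !pw// !gtr0_norm// mulrACA.
Qed.

Let momentD a b : (moment a b = moment a.+1 b + moment a b.+1)%E.
Proof.
have [c c0 cE] := momentE; rewrite !cE -!natr1 !addrA beta_integralD.
by rewrite ge0_muleDr// integral_ge0// => x _; rewrite lee_fin beta_density_ge0.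
Qed.

Let moment_ge0 a b : (0 <= moment a b)%E.
Proof. by apply: integral_ge0 => w _; rewrite lee_fin mulr_ge0// exprn_ge0. Qed.

Let moment00 : moment 0 0 = 1%:E.
Proof.
rewrite -(probability_setT P) -[RHS]mul1e -integral_cst//.
by apply: eq_integral => w _; rewrite !expr0 mulr1.
Qed.

Let moment_le1 a b : (moment a b <= 1)%E.
Proof.
elim: a b => [|a IH] b; last first.
  by rewrite (le_trans _ (IH b))// (momentD a b) leeDl.
elim: b => [|b IH]; first by rewrite moment00.
by rewrite (le_trans _ IH)// (momentD 0 b) leeDr.
Qed.

Let moment_parts a b :
  ((p + a%:R)%:E * moment a b.+1 = (q + b%:R)%:E * moment a.+1 b)%E.
Proof.
have [c c0 cE] := momentE; rewrite !cE -!natr1 !addrA.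
by rewrite muleCA beta_integral_parts 1?muleCA// ltr_wpDr.
Qed.

(** The relation x + (1 - x) = 1 and integration by parts form, at each [(a, b)], a linear system
    for [m a.+1 b] and [m a b.+1] in terms of [m a b]. Starting from the total mass one, it yields
    the moments without an evaluation of the beta function. *)
Lemma beta_moment a b : (\int[P]_w (`|Z w| ^+ a * `|1 - Z w| ^+ b)%:E =
  (rising p a * rising q b / rising (p + q) (a + b))%:E)%E.
Proof.
rewrite -/(moment a b).
have fin a' b' : moment a' b' \is a fin_num.
  by rewrite ge0_fin_numE// (le_lt_trans (moment_le1 _ _))// ltry.
pose m a b := fine (moment a b).
have mE a' b' : moment a' b' = (m a' b')%:E by rewrite fineK.
have mD a' b' : m a' b' = m a'.+1 b' + m a' b'.+1.
  by apply: EFin_inj; rewrite EFinD -!mE -momentD.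
have mP a' b' : (p + a'%:R) * m a' b'.+1 = (q + b'%:R) * m a'.+1 b'.
  by apply: EFin_inj; rewrite !EFinM -!mE -moment_parts.
have m00 : m 0 0 = 1 by rewrite /m moment00.
have pq0 n : p + q + n%:R != 0 by rewrite gt_eqF// ltr_wpDr// addr_gt0.
have mSl a' b' : m a'.+1 b' = (p + a'%:R) / (p + q + (a' + b')%:R) * m a' b'.
  apply: (mulfI (pq0 (a' + b')%N)); rewrite [RHS]mulrA [X in _ = X * _]mulrCA divff// mulr1.
  by have := mP a' b'; rewrite (mD a' b') natrD; lra.
have mSr a' b' : m a' b'.+1 = (q + b'%:R) / (p + q + (a' + b')%:R) * m a' b'.
  apply: (mulfI (pq0 (a' + b')%N)); rewrite [RHS]mulrA [X in _ = X * _]mulrCA divff// mulr1.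
  by have := mP a' b'; rewrite (mD a' b') natrD; lra.
rewrite mE; congr EFin.
have rS (x : R) n : rising x n.+1 = rising x n * (x + n%:R) by rewrite /rising big_ord_recr.
have r0 (x : R) : rising x 0 = 1 by rewrite /rising big_ord0.
elim: a b => [|a IH] b; last first.
  rewrite mSl IH addSn !rS invfM; ring.
elim: b => [|b IH]; first by rewrite m00 !r0 !mul1r invr1.
by rewrite mSr IH !add0n !rS invfM; ring.
Qed.

End beta_random_variable.

(** * The partition function of GEM and PD *)

(** Each entry paired with the list of the others: the block that receives a given label, and the
    blocks left for the remaining labels. *)
Fixpoint picks (ns : seq nat) : seq (nat * seq nat) :=
  if ns is n :: ns' then (n, ns') :: [seq (p.1, n :: p.2) | p <- picks ns']
  else [::].

Lemma picks_fst (ns : seq nat) : [seq p.1 | p <- picks ns] = ns.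
Proof. by elim: ns => //= n ns {2}<-; rewrite -map_comp. Qed.

Lemma perm_picks (ns : seq nat) p : p \in picks ns -> perm_eq ns (p.1 :: p.2).
Proof.
elim: ns p => //= n ns IH p; rewrite inE => /predU1P[->//|/mapP[q /IH qns ->]] /=.
rewrite (perm_trans (y := n :: q.1 :: q.2)) ?perm_cons//.
exact/permPl/(perm_catCA [:: n] [:: q.1] q.2).
Qed.

Section arrangement_sum.
Context (R : realType).
Implicit Types (ns L : seq nat) (x : nat -> R).

(* The sum, over the injective maps from the blocks [ns] to the labels [L], of
   the products of the [|x l| ^ n].  The absolute values make all integrands
   nonnegative without almost sure arguments. *)
Fixpoint arrangement_sum ns L x : R :=
  if ns is n :: ns' then
    \sum_(l <- L) `|x l| ^+ n * arrangement_sum ns' (rem l L) x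
  else 1.

Lemma arrangement_sum_ge0 ns L x : 0 <= arrangement_sum ns L x.
Proof.
elim: ns L => //= n ns IH L; apply: sumr_ge0 => l _.
by rewrite mulr_ge0// exprn_ge0.
Qed.

Lemma arrangement_sum_map ns L x (s : nat -> nat) : injective s ->
  arrangement_sum ns [seq s l | l <- L] x = arrangement_sum ns L (x \o s).
Proof.
move=> sI; elim: ns L => //= n ns IH L; rewrite big_map.
apply: eq_bigr => l _; congr (_ * _); rewrite -IH; congr arrangement_sum.
elim: L => //= a L IHL; rewrite (inj_eq sI); case: eqP => //= _.
by rewrite IHL.
Qed.

Lemma eq_arrangement_sum ns L x y : {in L, x =1 y} ->
  arrangement_sum ns L x = arrangement_sum ns L y.
Proof.
elim: ns L => //= n ns IH L xy; apply: eq_big_seq => l lL.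
by rewrite xy// IH// => k /mem_rem/xy.
Qed.

Lemma arrangement_sumZ ns L x (a : R) :
  arrangement_sum ns L (fun l => a * x l) =
  `|a| ^+ sumn ns * arrangement_sum ns L x.
Proof.
elim: ns L => [|n ns IH] L /=; first by rewrite mulr1.
rewrite mulr_sumr; apply: eq_bigr => l _.
by rewrite IH normrM exprMn exprD mulrACA.
Qed.

(** By injectivity the label [a] is used by no block or by exactly one, which [picks] singles
    out. *)
Lemma arrangement_sum_cons ns a L x : a \notin L ->
  arrangement_sum ns (a :: L) x = arrangement_sum ns L x +
    \sum_(p <- picks ns) `|x a| ^+ p.1 * arrangement_sum p.2 L x.
Proof.
elim: ns L => [|n ns IH] L aL /=; first by rewrite big_nil addr0.
rewrite !big_cons eqxx addrCA; congr (_ + _).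
rewrite big_map /=.
under [X in _ = _ + X]eq_bigr do rewrite mulr_sumr.
rewrite exchange_big -big_split /=; apply: eq_big_seq => l lL.
rewrite ifN; last by apply: contraNN aL => /eqP->.
rewrite IH; last by apply: contraNN aL => /mem_rem.
rewrite mulrDr mulr_sumr; congr (_ + _).
by apply: eq_bigr => p _; rewrite mulrCA.
Qed.

Lemma le_arrangement_sum ns L L' x : uniq L -> uniq L' -> {subset L <= L'} ->
  arrangement_sum ns L x <= arrangement_sum ns L' x.
Proof.
elim: ns L L' => //= n ns IH L L' uL uL' LL'.
have pL : perm_eq L' (L ++ [seq l <- L' | l \notin L]).
  apply: uniq_perm => //.
    rewrite cat_uniq uL filter_uniq// andbT/=; apply/hasPn => l.
    by rewrite mem_filter => /andP[].
  move=> l; rewrite mem_cat mem_filter; case: (boolP (l \in L)) => //= /LL'.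
  by [].
rewrite (perm_big _ pL) big_cat/= -[leLHS]addr0; apply: lerD.
  rewrite big_seq [leRHS]big_seq; apply: ler_sum => l lL.
  rewrite ler_wpM2l ?exprn_ge0//; apply: IH; rewrite ?rem_uniq//.
  by move=> k; rewrite !mem_rem_uniq// !inE => /andP[-> /LL'].
by apply: sumr_ge0 => l _; rewrite mulr_ge0 ?exprn_ge0// arrangement_sum_ge0.
Qed.

Lemma measurable_coordinate (i : nat) :
  measurable_fun [set: seq_space R] (fun x : seq_space R => x i).
Proof.
move=> _ B mB; rewrite setTI; apply: sub_sigma_algebra.
by exists i => //; exists B => //; rewrite setTI.
Qed.

Lemma measurable_arrangement_sum ns L :
  measurable_fun [set: seq_space R] (arrangement_sum ns L : seq_space R -> R).
Proof.
elim: ns L => [|n ns IH] L /=; first exact: measurable_cst.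
apply: measurable_sum => l; apply: measurable_funM => //.
apply: measurable_funX; apply: measurableT_comp; first exact: normr_measurable.
exact: measurable_coordinate.
Qed.

End arrangement_sum.

Section eppf.
Context (R : realType).
Implicit Types (a t : R) (ns : seq nat).

Lemma rising0 (x : R) : rising x 0 = 1. Proof. by rewrite /rising big_ord0. Qed.

Lemma risingS (x : R) n : rising x n.+1 = rising x n * (x + n%:R).
Proof. by rewrite /rising big_ord_recr. Qed.

Lemma risingSl (x : R) n : rising x n.+1 = x * rising (x + 1) n.
Proof.
rewrite /rising big_ord_recl addr0; congr (_ * _); apply: eq_bigr => i _.
by rewrite /= /bump/= add1n -natr1 addrAC addrA.
Qed.

Lemma rising_gt0 (x : R) n : 0 < x -> 0 < rising x n.
Proof. by move=> x0; apply: prodr_gt0 => i _; rewrite ltr_wpDr. Qed.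

(* Pitman's formula, with a common factor [t] left in the numerator and in the
   denominator. *)
Definition eppf a t ns : R :=
  (\prod_(i < size ns) (t + i%:R * a)) * (\prod_(n <- ns) rising (1 - a) n.-1)
  / rising t (sumn ns).

Lemma eppf_ge0 a t ns : 0 <= a < 1 -> 0 < t -> 0 <= eppf a t ns.
Proof.
move=> /andP[a0 a1] t0; rewrite /eppf divr_ge0 ?mulr_ge0 ?ltW ?rising_gt0//.
  by apply: prodr_gt0 => i _; rewrite ltr_wpDr// mulr_ge0.
by apply: prodr_gt0 => n _; rewrite rising_gt0// subr_gt0.
Qed.

(* The first stick, of law Beta(1 - a, t + a), is taken by no block or by the
   block of size [p.1]; the remaining sticks form a GEM(a, t + a). *)
Lemma eppf_rec a t ns : 0 <= a < 1 -> 0 < t -> all (fun n => 0 < n)%N ns ->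
  let I b c := rising (1 - a) b * rising (t + a) c / rising (t + 1) (b + c) in
  eppf a t ns = I 0 (sumn ns) * eppf a (t + a) ns +
    \sum_(p <- picks ns) I p.1 (sumn p.2) * eppf a (t + a) p.2.
Proof.
move=> /andP[a0 a1] t0 ns0 I.
have ta0 : 0 < t + a by rewrite ltr_wpDr.
have t1 : 0 < t + 1 by rewrite addr_gt0.
have rne (x : R) n : 0 < x -> rising x n != 0 by move=> x0; rewrite gt_eqF ?rising_gt0.
have [->|nsN] := eqVneq ns [::].
  by rewrite /eppf /= big_nil /I !rising0 !big_nil !big_ord0; field.
have [k sk] : exists k, size ns = k.+1 by case: ns nsN {ns0} => // n ns _; exists (size ns).
pose W : R := \prod_(n <- ns) rising (1 - a) n.-1.
(* All three terms are multiples of [Q]. For k + 1 blocks of sizes n_i and total size n the claim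
   becomes t + n = (t + a + k a) + sum of the (n_i - a). *)
pose Q := (\prod_(i < k) (t + a + i%:R * a)) * W / rising (t + 1) (sumn ns).
have prodS : \prod_(i < k.+1) (t + i%:R * a) = t * \prod_(i < k) (t + a + i%:R * a).
  rewrite big_ord_recl mul0r addr0; congr (_ * _); apply: eq_bigr => i _.
  by rewrite /= /bump/= add1n -natr1; ring.
transitivity ((t + (sumn ns)%:R) * Q).
  rewrite /eppf sk prodS -/W /Q.
  have := risingSl t (sumn ns); rewrite risingS => /(canRL (mulfK _)) -> //.
    by field; rewrite !gt_eqF ?rising_gt0// ltr_wpDr.
  by rewrite gt_eqF// ltr_wpDr.
have -> : I 0%N (sumn ns) * eppf a (t + a) ns = (t + a + k%:R * a) * Q.
  rewrite /I /eppf sk big_ord_recr/= -/W rising0 mul1r add0n /Q.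
  by field; rewrite !rne.
have -> : \sum_(p <- picks ns) I p.1 (sumn p.2) * eppf a (t + a) p.2 =
    \sum_(p <- picks ns) (p.1%:R - a) * Q.
  apply: eq_big_seq => p /perm_picks pp.
  have sp : size p.2 = k by have := perm_size pp; rewrite sk => -[].
  have np : sumn ns = (p.1 + sumn p.2)%N by rewrite (perm_sumn pp).
  have p0 : (0 < p.1)%N by have := perm_all (fun n => 0 < n)%N pp; rewrite ns0 => /esym/andP[].
  rewrite /eppf /I sp -np /Q /W (perm_big _ pp) big_cons /=.
  have -> : rising (1 - a) p.1 = rising (1 - a) p.1.-1 * (p.1%:R - a).
    by move: p0; case: p.1 => // m _; rewrite risingS -natr1 /=; congr (_ * _); ring.
  by field; rewrite !rne.
rewrite -mulr_suml -mulrDl; congr (_ * _).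
have -> : \sum_(p <- picks ns) (p.1%:R - a) = (sumn ns)%:R - k.+1%:R * a.
  rewrite -(big_map fst xpredT (fun n : nat => n%:R - a)) picks_fst -sk.
  elim: (ns) => [|n l IH] /=; first by rewrite big_nil mul0r subr0.
  by rewrite big_cons IH natrD -natr1; ring.
by rewrite -natr1; ring.
Qed.

End eppf.

Lemma measurable_seq_space d (Om : measurableType d) d' (E : measurableType d')
    (f : Om -> seq_space E) :
  (forall i, measurable_fun [set: Om] (fun w => f w i)) ->
  measurable_fun [set: Om] f.
Proof.
move=> mf; apply: (@measurability _ _ Om (seq_space E) setT f (@cylinders _ E)) => //.
move=> _ [_ [i _ [B mB <-]] <-].
rewrite setTI; have := mf i measurableT B mB; rewrite !setTI.
by [].
Qed.

Section stick_breaking_bound.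
Context (R : realType).
Implicit Types (y z : nat -> R) (ns : seq nat).

Lemma stick_breakingS z i :
  stick_breaking z i.+1 = (1 - z 0%N) * stick_breaking (z \o succn) i.
Proof. by rewrite /stick_breaking big_ord_recl mulrCA. Qed.

(** The pathwise form of conditioning on the first stick: every other label carries the factor
    [1 - z 0] and a stick of the shifted sequence. The entry [(0, ns)] stands for no block on the
    first label. *)
Lemma arrangement_sum_stick ns M z :
  arrangement_sum ns (iota 0 M.+1) (stick_breaking z) =
  \sum_(q <- (0%N, ns) :: picks ns) `|z 0%N| ^+ q.1 * `|1 - z 0%N| ^+ sumn q.2 *
     arrangement_sum q.2 (iota 0 M) (stick_breaking (z \o succn)).
Proof.
have shift ms : arrangement_sum ms (iota 1 M) (stick_breaking z) =
    `|1 - z 0%N| ^+ sumn ms *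
      arrangement_sum ms (iota 0 M) (stick_breaking (z \o succn)).
  rewrite (iotaDl 1 0) arrangement_sum_map//; last exact: succn_inj.
  rewrite -arrangement_sumZ; apply: eq_arrangement_sum => i _.
  exact: stick_breakingS.
rewrite /= arrangement_sum_cons; last by rewrite mem_iota.
rewrite big_cons mul1r shift; congr (_ + _); apply: eq_bigr => q _.
by rewrite shift {1}/stick_breaking big_ord0 mulr1 mulrA.
Qed.

Section with_factors.
Context d (Om : measurableType d) (P : probability Om R) (Z : nat -> {RV P >-> R}).
Variables (a t : R).
Hypotheses (a01 : 0 <= a < 1) (t0 : 0 < t) (indepZ : mutually_independent Z).
Hypothesis betaZ : forall j,
  is_beta (1 - a) (t + j.+1%:R * a) (distribution P (Z j)).

Lemma measurable_stick_breaking m : measurable_fun [set: Om]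
  (fun w => stick_breaking (fun j => Z (m + j)%N w) : seq_space R).
Proof.
apply: measurable_seq_space => i; apply: measurable_funM => //.
apply: measurable_prod => j _; exact: measurable_funB.
Qed.

Let f (u v : nat -> nat) j (x : R) := `|x| ^+ u j * `|1 - x| ^+ v j.

Let f0 u v j x : 0 <= f u v j x.
Proof. by rewrite mulr_ge0// exprn_ge0. Qed.

Let mf u v j : measurable_fun [set: R] (f u v j).
Proof.
apply: measurable_funM; apply: measurable_funX; first exact: normr_measurable.
apply: measurableT_comp; first exact: normr_measurable.
exact: measurable_funB.
Qed.

Let I j b c : R := rising (1 - a) b * rising (t + j%:R * a + a) c /
                   rising (t + j%:R * a + 1) (b + c).

Let integral_f u v j : (\int[P]_w (f u v j (Z j w))%:E = (I j (u j) (v j))%:E)%E.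
Proof.
have /andP[a0 a1] := a01.
rewrite /f (beta_moment _ _ (betaZ j)) ?subr_gt0//; last first.
  by rewrite ltr_wpDr// mulr_ge0.
by rewrite /I -natr1; congr ((_ * rising _ _ / rising _ _)%:E); ring.
Qed.

(* [m] sticks are already broken, and [M] labels remain; the factors [f] record
   what the blocks placed so far ask of the broken sticks. *)
Let eppf_bound M m ns u v : all (fun n => 0 < n)%N ns ->
  (\int[P]_w (\prod_(j <- iota 0 m) f u v j (Z j w) *
      arrangement_sum ns (iota 0 M)
        (stick_breaking (fun j => Z (m + j)%N w)))%:E <=
   (\prod_(j <- iota 0 m) I j (u j) (v j) * eppf a (t + m%:R * a) ns)%:E)%E.
Proof.
have /andP[a0 a1] := a01.
have tm m' : 0 < t + m'%:R * a by rewrite ltr_wpDr// mulr_ge0.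
elim: M m ns u v => [|M IH] m ns u v ns0.
  case: ns ns0 => [|n ns] ns0.
    under eq_integral do rewrite mulr1.
    rewrite /eppf /= big_ord0 big_nil rising0 !mulr1 invr1 !mulr1.
    by rewrite (integral_prod_independent indepZ (mf u v) (f0 u v) (iota_uniq 0 m)
                  (fun j _ => integral_f u v j)).
  (* The only loss in the induction: blocks are left but no labels, and the left side vanishes. *)
  under eq_integral do rewrite /= big_nil mulr0.
  rewrite integral0 lee_fin mulr_ge0 ?eppf_ge0//.
  apply: prodr_ge0 => j _; rewrite /I divr_ge0 ?mulr_ge0// ltW// rising_gt0//.
  - by rewrite subr_gt0.
  - by rewrite ltr_wpDr.
  - by rewrite addr_gt0.
(* Breaking stick [m] records two exponents: the size of the block placed on it, and the total size
   of the blocks still to be placed, whose labels all carry the factor [1 - Z m]. *)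
pose upd (u : nat -> nat) n j := if j == m then n else u j.
have updP (F : nat -> nat -> nat -> R) n1 n2 :
    \prod_(j <- iota 0 m.+1) F j (upd u n1 j) (upd v n2 j) =
    \prod_(j <- iota 0 m) F j (u j) (v j) * F m n1 n2.
  rewrite -addn1 iotaD big_cat big_seq1 add0n; congr (_ * _).
    apply: eq_big_seq => j; rewrite mem_iota add0n leq0n /upd /=.
    by case: eqP => // ->; rewrite ltnn.
  by rewrite /upd eqxx.
pose G (q : nat * seq nat) w : R :=
  \prod_(j <- iota 0 m.+1) f (upd u q.1) (upd v (sumn q.2)) j (Z j w) *
    arrangement_sum q.2 (iota 0 M) (stick_breaking (fun j => Z (m.+1 + j)%N w)).
have GE w : \prod_(j <- iota 0 m) f u v j (Z j w) *
      arrangement_sum ns (iota 0 M.+1)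
        (stick_breaking (fun j => Z (m + j)%N w)) =
    \sum_(q <- (0%N, ns) :: picks ns) G q w.
  rewrite arrangement_sum_stick mulr_sumr; apply: eq_bigr => q _.
  rewrite /G (updP (fun j b c => `|Z j w| ^+ b * `|1 - Z j w| ^+ c)).
  rewrite addn0 !mulrA; congr (_ * arrangement_sum _ _ (stick_breaking _)).
  by apply/funext => j /=; rewrite addSnnS.
under eq_integral do rewrite GE -sumEFin.
have G0 q w : 0 <= G q w.
  by rewrite /G mulr_ge0 ?arrangement_sum_ge0 ?prodr_ge0.
rewrite ge0_integral_sum//; last 2 first.
- move=> q; apply/measurable_EFinP; apply: measurable_funM.
    by apply: measurable_prod => j _; exact: measurableT_comp.
  apply: (@measurableT_comp _ _ _ _ _ _ (arrangement_sum _ _ : seq_space R -> R)).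
    exact: measurable_arrangement_sum.
  exact: measurable_stick_breaking.
- by move=> q w _; rewrite lee_fin.
rewrite (eppf_rec a01 (tm m) ns0) -[X in (X + _)%R]/(I _ _ _ * _).
apply: (@le_trans _ _ (\sum_(q <- (0%N, ns) :: picks ns)
    (\prod_(j <- iota 0 m) I j (u j) (v j) * (I m q.1 (sumn q.2) *
       eppf a (t + m.+1%:R * a) q.2))%:E)%E).
  rewrite big_seq [leRHS]big_seq; apply: lee_sum => q qP.
  have q0 : all (fun n => 0 < n)%N q.2.
    move: qP; rewrite inE => /predU1P[->//|/perm_picks/(perm_all (fun n => 0 < n)%N)].
    by rewrite ns0 => /esym/andP[].
  apply: (le_trans (IH m.+1 q.2 (upd u q.1) (upd v (sumn q.2)) q0)).
  by rewrite (updP I) mulrA.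
rewrite sumEFin lee_fin -mulr_sumr big_cons /=.
by rewrite -natr1 mulrDl mul1r addrA.
Qed.

Lemma GEM_arrangement_sum M ns : all (fun n => 0 < n)%N ns ->
  (\int[P]_w (arrangement_sum ns (iota 0 M)
     (stick_breaking (fun j => Z j w)))%:E <= (eppf a t ns)%:E)%E.
Proof.
move=> ns0; have := @eppf_bound M 0 ns (fun=> 0%N) (fun=> 0%N) ns0.
rewrite big_nil mul0r addr0 mul1r; congr (_ <= _)%E.
by apply: eq_integral => w _; rewrite big_nil mul1r.
Qed.

End with_factors.
End stick_breaking_bound.

Section poisson_dirichlet_bound.
Context (R : realType) (a t : R).
Hypotheses (a01 : 0 <= a < 1) (t0 : 0 < t).

Let g ns M (x : seq_space R) : R := arrangement_sum ns (iota 0 M) x.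

Let mg ns M : measurable_fun [set: seq_space R] (EFin \o g ns M).
Proof. by apply/measurable_EFinP; exact: measurable_arrangement_sum. Qed.

Let g0 ns M x : (0 <= (g ns M x)%:E)%E.
Proof. by rewrite lee_fin arrangement_sum_ge0. Qed.

Lemma is_GEM_arrangement_sum (mu : probability (seq_space R) R) M ns :
  is_GEM a t mu -> all (fun n => 0 < n)%N ns ->
  (\int[mu]_x (arrangement_sum ns (iota 0 M) x)%:E <= (eppf a t ns)%:E)%E.
Proof.
move=> [d [Om [P [Z [indepZ betaZ muE]]]]] ns0.
apply: le_trans (GEM_arrangement_sum a01 t0 indepZ betaZ M ns0).
have mphi := measurable_stick_breaking Z 0.
rewrite (eq_measure_integral (pushforward P
  (fun w => stick_breaking (fun j => Z (0 + j)%N w) : seq_space R))); last first.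
  by move=> A mA _; exact: muE.
rewrite (ge0_integral_pushforward mphi P measurableT (mg ns M)) ?preimage_setT//.
by move=> x _; exact: g0.
Qed.

Let g_cvg ns (x : seq_space R) M : ((g ns M x)%:E <= limn (fun n => (g ns n x)%:E))%E.
Proof.
have nd : nondecreasing_seq (fun n => (g ns n x)%:E).
  move=> m n mn; rewrite lee_fin; apply: le_arrangement_sum; rewrite ?iota_uniq//.
  by move=> l; rewrite !mem_iota !add0n => /leq_trans; apply.
apply: lime_ge; first exact: ereal_nondecreasing_is_cvgn.
by exists M => // n /= Mn; exact: nd.
Qed.

(** The first [M] coordinates of the reordered vector sit at random labels of the GEM vector, with
    no uniform bound. The integrand is therefore dominated by the limit over the label sets
    [iota 0 n], and monotone convergence applies because the GEM bound is uniform in [n]. *)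
Lemma is_PD_arrangement_sum (mu : probability (seq_space R) R) M ns :
  is_PD a t mu -> all (fun n => 0 < n)%N ns ->
  (\int[mu]_x (arrangement_sum ns (iota 0 M) x)%:E <= (eppf a t ns)%:E)%E.
Proof.
move=> [d [Om [P [X [X' [GX XX' muE]]]]]] ns0.
have nd x : {homo (fun n => (g ns n x)%:E) : m n / (m <= n)%N >-> (m <= n)%E}.
  move=> m n mn; rewrite lee_fin; apply: le_arrangement_sum; rewrite ?iota_uniq//.
  by move=> l; rewrite !mem_iota !add0n => /leq_trans; apply.
have mgX (Y : {RV P >-> seq_space R}) n :
    measurable_fun [set: Om] (fun w => (g ns n (Y w))%:E).
  exact: (measurableT_comp (mg ns n)).
rewrite (eq_measure_integral (distribution P X')); last first.
  by move=> A mA _; exact: muE.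
rewrite (ge0_integral_distribution X' (mg ns M))//=.
apply: (@le_trans _ _ (\int[P]_w (limn (fun n => (g ns n (X w))%:E)))%E).
  apply: ae_ge0_le_integral => //.
  - by move=> w _; apply: le_trans (g_cvg ns (X w) 0); exact: g0.
  - apply: (@emeasurable_fun_cvg _ _ _ _ (fun n w => (g ns n (X w))%:E)).
      exact: mgX.
    by move=> w _; exact: ereal_nondecreasing_is_cvgn (nd _).
  apply: filterS XX' => w [_ [s /bij_inj sI XsX]] _; rewrite XsX.
  rewrite /g -arrangement_sum_map//.
  pose K := (\max_(l <- [seq s l | l <- iota 0 M]) l).+1.
  apply: le_trans (g_cvg ns (X w) K); rewrite lee_fin.
  apply: le_arrangement_sum; rewrite ?iota_uniq ?map_inj_uniq ?iota_uniq//.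
  by move=> l lM; rewrite mem_iota leq0n add0n ltnS; exact: leq_bigmax_seq.
rewrite monotone_convergence//.
apply: lime_le.
  apply: ereal_nondecreasing_is_cvgn => m n mn; apply: ge0_le_integral => // w _; exact: nd.
apply: nearW => n; rewrite -(ge0_integral_distribution X (mg ns n))//.
  exact: is_GEM_arrangement_sum.
by move=> x; exact: g0.
Qed.

End poisson_dirichlet_bound.

(** * Histories of growing trees *)

Local Notation root := Defs.root.

Section histories.
Local Open Scope nat_scope.
Implicit Types (h g : seq node) (u v x b : node).

(* The nodes of a growing tree in order of appearance. *)
Inductive history : seq node -> Prop :=
| history_root : history [:: root]
| history_rcons h v i : history h -> v \in h -> rcons v i \notin h ->
    history (rcons h (rcons v i)).

Lemma parent_rcons v i : parent (rcons v i) = v.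
Proof. by rewrite /parent size_rcons /= -cats1 take_size_cat. Qed.

Lemma size_parent v : size (parent v) = (size v).-1.
Proof. by rewrite size_takel// leq_pred. Qed.

Lemma rcons_parent v : v != root -> exists i, v = rcons (parent v) i.
Proof.
by case/lastP: v => // v i _; exists i; rewrite parent_rcons.
Qed.

Lemma rcons_neq_root v i : rcons v i != root.
Proof. by rewrite -size_eq0 size_rcons. Qed.

Lemma history_uniq h : history h -> uniq h.
Proof. by elim=> // {}h v i _ uh _ vi; rewrite rcons_uniq vi. Qed.

Lemma history_root_in h : history h -> root \in h.
Proof. by elim=> // {}h v i _ rh _ _; rewrite mem_rcons inE rh orbT. Qed.

Lemma history_take h x k : history h -> x \in h -> take k x \in h.
Proof.
move=> hh; elim: hh x k => [x k|{}h v i _ IH vh _ x k].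
  by rewrite !inE => /eqP->.
rewrite mem_rcons inE => /predU1P[->|xh]; last first.
  by rewrite mem_rcons inE IH ?orbT.
have [ki|ki] := leqP k (size v).
  by rewrite -cats1 takel_cat// mem_rcons inE IH ?orbT.
by rewrite take_oversize ?size_rcons// mem_rcons inE eqxx.
Qed.

Lemma history_size h : history h -> 0 < size h.
Proof. by case=> // *; rewrite size_rcons. Qed.

Lemma history_prefix h m : history h -> m < size h -> history (take m.+1 h).
Proof.
move=> hh; elim: hh m => [[|m]//|{}h v i hh IH vh vi m] /=; first by left.
rewrite size_rcons ltnS leq_eqVlt => /predU1P[->|mh].
  by rewrite take_oversize ?size_rcons//; right.
by rewrite -cats1 takel_cat//; exact: IH.
Qed.

Definition sibs h v : seq node := [seq u <- h | (u != root) && (parent u == v)].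

Definition deg h v : nat := size (sibs h v).

(* The number of siblings of [x] that precede it in [h]. *)
Definition rank h x : nat := deg (take (index x h) h) (parent x).

Definition relab h x : node := mkseq (fun k => rank h (take k.+1 x)) (size x).

(** The history of the relabelled sequence, by [follows_unordered]; positions in the list are
    kept. *)
Definition canon h : seq node := [seq relab h x | x <- h].

Lemma sibs_cat h g v : sibs (h ++ g) v = sibs h v ++ sibs g v.
Proof. exact: filter_cat. Qed.

Lemma rank_cat h g x : x \in h -> rank (h ++ g) x = rank h x.
Proof.
by move=> xh; rewrite /rank index_cat xh takel_cat// index_size.
Qed.

(** A rank looks at earlier siblings only, and [h] contains all ancestors of [x]. *)
Lemma relab_cat h g x : history h -> x \in h -> relab (h ++ g) x = relab h x.
Proof.
move=> hh xh; apply: eq_map => k; apply: rank_cat.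
exact: history_take.
Qed.

Lemma size_relab h x : size (relab h x) = size x.
Proof. exact: size_mkseq. Qed.

Lemma relab_rcons h v i : history h -> v \in h -> rcons v i \notin h ->
  relab (rcons h (rcons v i)) (rcons v i) = rcons (relab h v) (deg h v).
Proof.
move=> hh vh vi; rewrite /relab size_rcons mkseqS; congr rcons.
  apply: (@eq_from_nth _ 0); rewrite ?size_mkseq// => k kv.
  rewrite !nth_mkseq// -(cats1 v i) takel_cat// -(cats1 h) rank_cat//.
  exact: history_take.
rewrite take_oversize ?size_rcons// /rank parent_rcons -(cats1 h) index_cat (negPf vi).
by rewrite /= eqxx addn0 take_size_cat.
Qed.

Lemma canon_rcons h v i : history h -> v \in h -> rcons v i \notin h ->
  canon (rcons h (rcons v i)) = rcons (canon h) (rcons (relab h v) (deg h v)).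
Proof.
move=> hh vh vi; rewrite /canon map_rcons relab_rcons//; congr rcons.
by apply/eq_in_map => x xh; rewrite -(cats1 h) relab_cat.
Qed.

Lemma canon_take h m : history h -> m < size h ->
  take m.+1 (canon h) = canon (take m.+1 h).
Proof.
move=> hh mh; rewrite /canon -map_take; apply/eq_in_map => x xm.
rewrite -{1}(cat_take_drop m.+1 h) relab_cat//.
exact: history_prefix.
Qed.

Lemma parent_relab h x : history h -> x \in h ->
  parent (relab h x) = relab h (parent x).
Proof.
move=> hh xh; apply: (@eq_from_nth _ 0).
  by rewrite size_parent !size_relab size_parent.
move=> k; rewrite size_parent size_relab => kx.
have kx' : k < size x by rewrite (leq_trans kx)// leq_pred.
rewrite /parent nth_take ?size_relab// /relab !nth_mkseq ?size_takel ?leq_pred//.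
by rewrite take_takel.
Qed.

Lemma relab_eq_root h x : (relab h x == root) = (x == root).
Proof. by rewrite -!size_eq0 size_relab. Qed.

Lemma rank_inj h x y : x \in h -> y \in h -> x != root -> y != root ->
  parent x = parent y -> rank h x = rank h y -> x = y.
Proof.
move=> xh yh x0 y0 pxy.
wlog xy : x y xh yh x0 y0 pxy / index x h <= index y h.
  move=> H; have [|/ltnW] := leqP (index x h) (index y h); first exact: H.
  by move=> yx rxy; apply/esym/H.
rewrite leq_eqVlt in xy; case/predU1P: xy => [xy _|xy].
  by rewrite -(nth_index root xh) xy nth_index.
rewrite /rank -pxy -(subnKC xy) => /eqP; rewrite ltn_eqF//.
rewrite addSnnS takeD /deg sibs_cat size_cat -addn1 leq_add2l.
rewrite (drop_nth root) ?index_mem// /= nth_index//.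
by rewrite /sibs /= x0 eqxx.
Qed.

(** Induction on the depth: the parents agree, and siblings are separated by their ranks. *)
Lemma relab_inj h : history h -> {in h &, injective (relab h)}.
Proof.
move=> hh x; have [n] := ubnP (size x); elim: n x => // n IH x sx y xh yh xy.
have [x0|x0] := eqVneq x root.
  by apply/esym/eqP; rewrite x0 -(relab_eq_root h) -xy relab_eq_root x0.
have y0 : y != root by rewrite -(relab_eq_root h) -xy relab_eq_root.
have szx : 0 < size x by case: (x) x0.
have sxy : size x = size y by rewrite -(size_relab h) xy size_relab.
have pxy : parent x = parent y.
  apply: IH; rewrite ?history_take//; last by rewrite -!parent_relab// xy.
  by rewrite size_parent -ltnS prednK.
apply: (@rank_inj h) => //.
have := congr1 (nth 0 ^~ (size x).-1) xy.
by rewrite /relab !nth_mkseq -?sxy ?prednK// take_size sxy take_size.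
Qed.

Lemma sibs_canon h v : history h -> v \in h ->
  sibs (canon h) (relab h v) = [seq relab h u | u <- sibs h v].
Proof.
move=> hh vh; rewrite /sibs filter_map; congr map; apply: eq_in_filter => u uh /=.
rewrite relab_eq_root parent_relab//; congr (_ && _).
by apply: (inj_in_eq (relab_inj hh)) => //; exact: history_take.
Qed.

Lemma deg_canon h v : history h -> v \in h -> deg (canon h) (relab h v) = deg h v.
Proof. by move=> hh vh; rewrite /deg sibs_canon// size_map. Qed.

Fixpoint canonical_histories n : seq (seq node) :=
  if n is n'.+1 then
    [seq rcons w (rcons v (deg w v)) | w <- canonical_histories n', v <- w]
  else [:: [:: root]].

Lemma size_canonical n w : w \in canonical_histories n -> size w = n.+1.
Proof.
elim: n w => [|n IH] w /=; first by rewrite inE => /eqP->.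
by move=> /allpairsPdep[w' [v [/IH sw _ ->]]]; rewrite size_rcons sw.
Qed.

Lemma canon_canonical h n : history h -> size h = n.+1 ->
  canon h \in canonical_histories n.
Proof.
move=> hh; elim: hh n => [n [<-]//|{}h v i hh IH vh vi n].
rewrite size_rcons => -[sh]; rewrite canon_rcons//.
case: n sh => [sh|n /IH Ih]; first by have := history_size hh; rewrite sh.
apply/allpairsPdep; exists (canon h), (relab h v); split => //.
  exact: map_f.
by rewrite deg_canon.
Qed.

Lemma rcons_deg_notin h v : history h ->
  (forall u, sibs h u = [seq rcons u i | i <- iota 0 (deg h u)]) ->
  rcons v (deg h v) \notin h.
Proof.
move=> hh sh; apply/negP => vh.
have : rcons v (deg h v) \in sibs h v.
  by rewrite mem_filter rcons_neq_root parent_rcons eqxx.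
rewrite sh => /mapP[i]; rewrite mem_iota => /= ilt /rcons_inj[id].
by rewrite id ltnn in ilt.
Qed.

Lemma canonicalP n w : w \in canonical_histories n ->
  history w /\ forall v, sibs w v = [seq rcons v i | i <- iota 0 (deg w v)].
Proof.
elim: n w => [|n IH] w /=.
  by rewrite inE => /eqP->; split => //; left.
move=> /allpairsPdep[w' [v [/IH[hw' sw'] vw' ->]]].
have vi := rcons_deg_notin v hw' sw'.
split; first by right.
move=> u; rewrite /deg -(cats1 w') !sibs_cat size_cat.
have -> : sibs [:: rcons v (deg w' v)] u = if v == u then [:: rcons v (deg w' v)] else [::].
  by rewrite /sibs /= rcons_neq_root parent_rcons.
have [<-|vu] := eqVneq v u; last by rewrite cats0 addn0; exact: sw'.
by rewrite iotaD map_cat -sw'.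
Qed.

End histories.

(** * Sequences of trees *)

Section tree_sequences.
Local Open Scope nat_scope.
Implicit Types (h g : seq node) (u v x b : node) (t : nat -> tree).

Definition tset h : tree := [fset x in h]%fset.

Lemma in_tset h x : (x \in tset h) = (x \in h).
Proof. by rewrite !inE. Qed.

Lemma tset_rcons h x : tset (rcons h x) = (x |` tset h)%fset.
Proof. by apply/fsetP => y; rewrite !inE mem_rcons inE. Qed.

Lemma card_tset h : uniq h -> #|` tset h|%fset = size h.
Proof. by move=> uh; rewrite card_fseq undup_id. Qed.

Lemma perm_tset h : uniq h -> perm_eq (tset h) h.
Proof.
by move=> uh; apply: uniq_perm; rewrite ?fset_uniq//; exact: in_tset.
Qed.

Definition follows h t := forall m, m < size h -> t m = tset (take m.+1 h).

(** Along a sequence that follows [h], to enter earlier means to have the smaller index in [h]. *)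
Lemma birth_rankE h t n x : history h -> follows h t -> n < size h ->
  x \in take n.+1 h -> x != root -> birth_rank t n x = rank h x.
Proof.
move=> hh ht nh xn x0; have uh := history_uniq hh.
have xh : x \in h := mem_take xn.
have xn' : index x h <= n by rewrite -ltnS -in_take.
rewrite /birth_rank /rank /deg -card_tset; last first.
  by rewrite filter_uniq// take_uniq.
congr (#|` _ |)%fset; apply/fsetP => u.
rewrite in_tset mem_filter !inE ht// in_tset.
rewrite -[LHS]andbA andbCA; congr (_ && _); apply/andP/idP.
  move=> [un /hasP[m]]; rewrite mem_iota add0n => /= mn.
  have mh : m < size h by rewrite (leq_ltn_trans _ nh)// -ltnS.
  rewrite ht// !in_tset => /andP[um].
  have uh' := mem_take um.
  rewrite !in_take// -leqNgt; rewrite in_take// in um.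
  exact: leq_trans.
move=> ux; have uh' := mem_take ux; rewrite in_take// in ux.
rewrite in_take// ltnS (leq_trans (ltnW ux) xn'); split => //.
(* At time [index u h] the node [u] has just entered and [x] is still absent. *)
apply/hasP; exists (index u h); first by rewrite mem_iota/= add0n ltnS (leq_trans (ltnW ux) xn').
by rewrite ht ?index_mem// !in_tset !in_take// ltnSn -leqNgt.
Qed.

Lemma unordered_follows h t n : history h -> follows h t -> n < size h ->
  unordered t n = tset (take n.+1 (canon h)).
Proof.
move=> hh ht nh; apply/fsetP => y; rewrite in_tset canon_take//.
have hg := history_prefix hh nh.
have rE x : x \in take n.+1 h -> relabel t n x = relab (take n.+1 h) x.
  move=> xn; rewrite -(@relab_cat _ (drop n.+1 h))// cat_take_drop.
  apply/eq_in_map => k; rewrite mem_iota add0n => /= kx.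
  apply: birth_rankE => //; first exact: history_take.
  by rewrite -size_eq0 size_takel.
apply/imfsetP/mapP => /= -[x xn ->]; exists x.
- by move: xn; rewrite ht// in_tset.
- by apply: rE; move: xn; rewrite ht// in_tset.
- by rewrite ht// in_tset.
- by rewrite rE.
Qed.

Lemma follows_rcons h t b : follows h t ->
  t (size h) = (b |` tset h)%fset -> follows (rcons h b) t.
Proof.
move=> ht tb m; rewrite size_rcons ltnS leq_eqVlt => /predU1P[->|mh].
  by rewrite tb -tset_rcons take_oversize// size_rcons.
by rewrite -cats1 takel_cat// ht.
Qed.

(** Each tree has exactly one node more than its predecessor, so the trees determine the order of
    appearance. This makes the events of distinct histories disjoint. *)
Lemma tset_inj_take h g : uniq h -> uniq g -> size h = size g ->
  (forall m, m < size h -> tset (take m.+1 h) = tset (take m.+1 g)) -> h = g.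
Proof.
elim/last_ind: h g => [|h b IH] g; first by case: g.
case/lastP: g => [|g c]; first by rewrite size_rcons.
rewrite !size_rcons !rcons_uniq => /andP[bh uh] /andP[cg ug] [shg] E.
have hg : h = g.
  apply: IH => // m mh; have := E m (leqW mh).
  by rewrite -!cats1 !takel_cat// -shg.
have := E _ (ltnSn _); rewrite !take_oversize ?size_rcons ?shg// => /fsetP/(_ b).
rewrite !in_tset !mem_rcons !inE eqxx /= -hg (negPf bh) orbF => /esym/eqP->.
by rewrite hg.
Qed.

End tree_sequences.

(** * Histories traced by the balls of a split tree *)

Section ball_paths.
Local Open Scope nat_scope.
Variable c : nat * node -> nat.
Implicit Types (v : node) (t : tree).

Let step k t v := if v \in t then rcons v (c (k, v)) else v.

Definition ball k : node := ball_position (fun v => c (k, v)) (full_nodes c k).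

Definition balls n : seq node := mkseq ball n.

(** The invariant of the descent: ball [k] has come through full nodes only, obeying its choices. *)
Let path_inv k t v := forall l, l < size v ->
  take l v \in t /\ nth 0 v l = c (k, take l v).

Let path_inv_iter k t m : path_inv k t (iter m (step k t) root).
Proof.
elim: m => //= m IH; rewrite {1}/step; case: ifP => // vt l.
rewrite size_rcons ltnS leq_eqVlt => /predU1P[->|lv].
  by rewrite -cats1 take_size_cat// nth_cat ltnn subnn.
by rewrite -cats1 takel_cat 1?ltnW// nth_cat lv; have := IH l lv.
Qed.

(** Pigeonhole: a ball still on a full node after [N] steps has met [N.+1] full nodes, distinct
    because their depths are 0, ..., [N]. *)
Let iter_notin k t : iter #|` t|%fset (step k t) root \notin t.
Proof.
set N := #|` t|%fset; apply/negP => Nt.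
have it m : m <= N -> iter m (step k t) root \in t.
  move=> mN; apply/negPn/negP => mt.
  suff : iter N (step k t) root = iter m (step k t) root by move=> e; rewrite e (negPf mt) in Nt.
  rewrite -(subnK mN) iterD; elim: (N - m) => //= j ->.
  by rewrite /step (negPf mt).
have sz m : m <= N.+1 -> size (iter m (step k t) root) = m.
  elim: m => //= m IH mN; rewrite {1}/step it// size_rcons IH//.
  exact: ltnW.
have sub : {subset [seq iter m (step k t) root | m <- iota 0 N.+1] <= t}.
  by move=> _ /mapP[m + ->]; rewrite mem_iota add0n ltnS => /= /it.
suff us : uniq [seq iter m (step k t) root | m <- iota 0 N.+1].
  by have := uniq_leq_size us sub; rewrite size_map size_iota -/N ltnn.
rewrite map_inj_in_uniq ?iota_uniq// => i j; rewrite !mem_iota !add0n => /= iN jN ij.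
by have := congr1 size ij; rewrite (sz i (ltnW iN)) (sz j (ltnW jN)).
Qed.

Lemma full_nodesE n : full_nodes c n = tset (balls n).
Proof.
elim: n => [|n IH] /=; first by apply/fsetP => x; rewrite in_tset inE.
by rewrite -/(ball n) {1}IH /balls mkseqS tset_rcons.
Qed.

Lemma ball_notin n : ball n \notin balls n.
Proof. by rewrite -in_tset -full_nodesE iter_notin. Qed.

Lemma ball_path n l : l < size (ball n) ->
  take l (ball n) \in balls n /\ nth 0 (ball n) l = c (n, take l (ball n)).
Proof.
move=> ln; rewrite -in_tset -full_nodesE.
exact: (@path_inv_iter n (full_nodes c n) #|` full_nodes c n|%fset l ln).
Qed.

Lemma history_balls n : history (balls n.+1).
Proof.
elim: n => [|n IH].
  suff b0 : ball 0 = root by rewrite (_ : balls 1 = [:: ball 0])// b0; left.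
  by rewrite /ball /ball_position full_nodesE card_tset.
rewrite /balls mkseqS -/(balls n.+1).
have b0 : ball n.+1 != root.
  by apply: contraNneq (ball_notin n.+1) => ->; exact: history_root_in.
have [i bE] := rcons_parent b0.
have sb : 0 < size (ball n.+1) by case: (ball n.+1) b0.
rewrite bE; right => //; last by rewrite -bE ball_notin.
by apply: (proj1 (ball_path _)); rewrite ltn_predL.
Qed.

Lemma follows_balls n : follows (balls n) (split_tree c).
Proof.
move=> m; rewrite size_mkseq => mn.
rewrite /split_tree full_nodesE; congr tset.
by rewrite /balls /mkseq -map_take take_iota (minn_idPl mn).
Qed.

End ball_paths.

(** Trees are countable, so [A] is a countable union of cylinders, one for each finite list of trees
    whose extension by [point] lies in [A]. *)
Lemma measurable_finitely_determined n (A : set (seq_space tree)) :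
  (forall x y : nat -> tree, (forall m, (m < n)%N -> x m = y m) -> A x -> A y) ->
  measurable A.
Proof.
move=> detA.
pose F (s : seq tree) : set (seq_space tree) := if pselect (A (nth point s)) then
  \bigcap_(m in `I_n) (fun x : seq_space tree => x m) @^-1` [set nth point s m]
  else set0.
have -> : A = \bigcup_s F s.
  apply/seteqP; split=> x.
    move=> Ax; exists (mkseq x n) => //; rewrite /F; case: pselect => [_ m mn|].
      by rewrite /= nth_mkseq.
    by case; apply: detA Ax => m mn; rewrite nth_mkseq.
  move=> [s _]; rewrite /F; case: pselect => // As xs.
  by apply: (detA _ _ _ As) => m mn; rewrite -(xs m).
apply: countable_bigcupT_measurable => [|s]; first exact: countableP.
rewrite /F; case: pselect => As; last exact: measurable0.
apply: fin_bigcap_measurable => // m _.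
apply: sub_sigma_algebra; exists m => //; exists [set nth point s m] => //.
by rewrite setTI.
Qed.

Section history_weight.
Context (R : realType).

(* The common probability of the unordered history [w] under both models. *)
Definition weight (w : seq node) : R :=
  (\prod_(v <- w) (deg w v)`!)%:R / \prod_(r < (size w).-1) (r.*2.+1)%:R.

Lemma deg_rcons h v i u :
  deg (rcons h (rcons v i)) u = (deg h u + (v == u))%N.
Proof.
rewrite /deg /sibs filter_rcons rcons_neq_root parent_rcons /=.
by case: eqP => _; rewrite ?size_rcons ?addn1 ?addn0.
Qed.

Lemma deg_notin h u : history h -> u \notin h -> deg h u = 0%N.
Proof.
move=> hh uh; apply/eqP; rewrite size_eq0 -[_ == _]negbK -has_filter.
apply/hasPn => x xh; apply: contraNN uh => /andP[_ /eqP<-].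
exact: history_take.
Qed.

Lemma outdegree_tset h v : history h -> outdegree (tset h) v = deg h v.
Proof.
move=> hh; rewrite /outdegree /deg -card_tset; last first.
  by rewrite filter_uniq// history_uniq.
congr (#|` _ |)%fset; apply/fsetP => u.
by rewrite in_tset mem_filter !inE andbC.
Qed.

Lemma sum_deg h : history h -> (\sum_(v <- h) deg h v).+1 = size h.
Proof.
elim=> [|{}h v i hh IH vh vi]; first by rewrite big_seq1.
rewrite -{1}cats1 big_cat big_seq1 /= deg_rcons size_rcons deg_notin//.
have -> : v == rcons v i = false by apply: contraNF vi => /eqP <-.
under eq_bigr do rewrite deg_rcons.
rewrite addn0 big_split/= -addSn IH -[RHS]addn1; congr addn.
rewrite (big_rem v)//= eqxx big1_seq// => u /=.
by rewrite mem_rem_uniq ?history_uniq// inE eq_sym => /andP[/negPf->].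
Qed.

(** Only the factorial at [v] grows, by the factor d(v) + 1; the new leaf contributes 0! = 1, and
    the denominator gains the odd number 2n + 1. *)
Lemma weight_rcons n w v : w \in canonical_histories n -> v \in w ->
  weight (rcons w (rcons v (deg w v))) =
  weight w * ((deg w v).+1%:R / (n.*2.+1)%:R).
Proof.
move=> wn vw; have [hw sw] := canonicalP wn.
have vd := rcons_deg_notin v hw sw.
rewrite /weight size_rcons (size_canonical wn) /= big_ord_recr /=.
have -> : (\prod_(u <- rcons w (rcons v (deg w v)))
    (deg (rcons w (rcons v (deg w v))) u)`! =
    (\prod_(u <- w) (deg w u)`!) * (deg w v).+1)%N.
  rewrite -{1}cats1 big_cat big_seq1 /= deg_rcons (deg_notin hw vd) add0n.
  have -> : v == rcons v (deg w v) = false by apply: contraNF vd => /eqP <-.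
  rewrite muln1.
  rewrite (big_rem v)//= [in RHS](big_rem v)//= deg_rcons eqxx addn1 factS.
  rewrite [RHS]mulnAC [in RHS](mulnC (_`!)).
  congr muln; apply: eq_big_seq => u.
  rewrite mem_rem_uniq ?history_uniq// inE => /andP[uv _].
  by rewrite deg_rcons eq_sym (negPf uv) addn0.
by rewrite natrM invfM; ring.
Qed.

End history_weight.

(** Serves to sum over the labelled histories of one shape, which all have the same transition
    probability [r]. *)
Lemma measure_bigcup_scale d (Om : measurableType d) (R : realType)
    (P : {measure set Om -> \bar R}) (F F' : nat -> set Om) (r : R) :
  (forall i, measurable (F i)) -> (forall i, measurable (F' i)) ->
  trivIset setT F -> trivIset setT F' ->
  (forall i, P (F' i) = P (F i) * r%:E)%E ->
  (P (\bigcup_i F' i) = P (\bigcup_i F i) * r%:E)%E.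
Proof.
move=> mF mF' tF tF' FF'; rewrite !measure_bigcup//.
under eq_eseriesr do rewrite FF' muleC.
by rewrite nneseriesZl 1?muleC.
Qed.

(** * Lower bound for preferential attachment *)

Section preferential_attachment_lower_bound.
Context (R : realType) d (Om : measurableType d) (P : probability Om R).
Variable T : {RV P >-> seq_space tree}.
Hypothesis PA : preferential_attachment T.

(** Since the label of a new child is free, infinitely many labelled histories [a] may share the
    shape [w]. *)
Definition relabelled_history (w : seq node) : set (seq_space tree) :=
  [set x | exists a, [/\ history a, canon a = w & follows a x]].

Let measurable_finitely_determinedT n (A : set (seq_space tree)) :
  (forall x y : nat -> tree, (forall m, (m < n)%N -> x m = y m) -> A x -> A y) ->
  measurable (T @^-1` A).
Proof.
move=> detA; rewrite -[X in measurable X]setTI.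
by apply: measurable_funPT => //; exact: (measurable_finitely_determined detA).
Qed.

(* [pickle_inv], unlike [unpickle], reaches each labelled history only once. *)
Let F (w : seq node) (i : nat) : set (seq_space tree) :=
  if @choice.pickle_inv (seq node) i is Some a then
  [set x | [/\ history a, canon a = w & follows a x]] else set0.

(** As [canon] keeps positions, [nth root a (index v w)] is the node of [a] that is relabelled
    [v]. *)
Let F' (w : seq node) (v : node) (i : nat) : set (seq_space tree) :=
  if @choice.pickle_inv (seq node) i is Some a then
  [set x | [/\ history a, canon a = w, follows a x &
     add_child (tset a) (x (size a)) (nth root a (index v w))]] else set0.

Let relabelled_historyE w : relabelled_history w = \bigcup_i F w i.
Proof.
apply/seteqP; split=> x; last first.
  by move=> [i _]; rewrite /F; case: choice.pickle_inv => // a; exists a.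
by move=> [a xa]; exists (choice.pickle a) => //; rewrite /F pickleK_inv.
Qed.

Lemma followsW a (x y : nat -> tree) n : (forall m, (m < n)%N -> x m = y m) ->
  (size a <= n)%N -> follows a x -> follows a y.
Proof. by move=> xy an ax m ma; rewrite -xy ?ax// (leq_trans ma). Qed.

Let mF w i : measurable (T @^-1` F w i).
Proof.
apply: (@measurable_finitely_determinedT (size w)) => x y xy; rewrite /F.
case: choice.pickle_inv => // a [ha aw ax]; split => //.
by apply: followsW xy _ ax; rewrite -aw size_map.
Qed.

Let mF' w v i : measurable (T @^-1` F' w v i).
Proof.
apply: (@measurable_finitely_determinedT (size w).+1) => x y xy; rewrite /F'.
case: choice.pickle_inv => // a [ha aw ax ac].
have sa : size a = size w by rewrite -aw size_map.
by split; rewrite // -?xy ?sa// -?sa//; apply: followsW xy _ ax; rewrite sa.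
Qed.

Let tF w : trivIset setT (fun i => T @^-1` F w i).
Proof.
move=> i j _ _ [om []].
rewrite /F /preimage /=.
case Ei: choice.pickle_inv => [a|//] [ha aw ax]; case Ej: choice.pickle_inv => [b|//] [hb bw bx].
have ab : a = b.
  apply: tset_inj_take; rewrite ?history_uniq//.
    by rewrite -(size_map (relab a)) -[map _ _]/(canon a) aw -bw size_map.
  move=> m ma; rewrite -ax// -bx//.
  by rewrite -(size_map (relab b)) -[map _ _]/(canon b) bw -aw size_map.
by rewrite -(@pickle_invK (seq node) i) -(@pickle_invK (seq node) j) Ei Ej /= ab.
Qed.

Let tF' w v : trivIset setT (fun i => T @^-1` F' w v i).
Proof.
have FF' i : T @^-1` F' w v i `<=` T @^-1` F w i.
  by move=> om; rewrite /F /F' /preimage /=; case: choice.pickle_inv => // a [].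
move=> i j _ _ [om [/FF' omi /FF' omj]].
by apply: (@tF w) => //; exists om.
Qed.

Let PF' n w v i : w \in canonical_histories n -> v \in w ->
  (P (T @^-1` F' w v i) =
   P (T @^-1` F w i) * ((deg w v).+1%:R / (n.*2.+1)%:R)%:E)%E.
Proof.
move=> wn vw; rewrite /F /F'; case: choice.pickle_inv => [a|]; last first.
  by rewrite preimage_set0 measure0 mul0e.
have [[ha aw]|naw] := pselect (history a /\ canon a = w); last first.
  rewrite (_ : _ @^-1` _ = set0); last by apply/seteqP; split => // x [? ?]; case: naw.
  rewrite [X in (_ = P X * _)%E](_ : _ = set0) ?measure0 ?mul0e//.
  by apply/seteqP; split => // x [? ?]; case: naw.
have sa : size a = n.+1.
  by rewrite -(size_canonical wn) -aw size_map.
have iw : (index v w < size a)%N by rewrite sa -(size_canonical wn) index_mem.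
set u := nth root a (index v w).
have ua : u \in a by rewrite mem_nth.
have uv : relab a u = v by rewrite /u -(nth_map _ root)// -[map _ _]/(canon a) aw nth_index.
pose t m := tset (take m.+1 a).
have tn : t n = tset a by rewrite /t -sa take_size.
have followsE om : follows a (T om) <-> forall m, (m <= n)%N -> T om m = t m.
  by split=> H m mn; apply: H; rewrite ?sa// -ltnS -sa.
have := PA.2 n t u; rewrite tn in_tset => /(_ ua).
rewrite outdegree_tset// -(deg_canon ha ua) aw uv.
(* A tree with n + 1 nodes has n edges, so the weights d + 1 add up to n + (n + 1). *)
have -> : \sum_(u0 <- tset a) (outdegree (tset a) u0).+1%:R = n.*2.+1%:R :> R.
  rewrite (perm_big _ (perm_tset (history_uniq ha))) /=.
  rewrite -natr_sum; congr (_%:R).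
  under eq_bigr do rewrite outdegree_tset// -addn1.
  have := sum_deg ha; rewrite sa => -[sd].
  by rewrite big_split/= sum1_size sd sa addnS addnn.
move=> H; rewrite [in LHS](_ : _ @^-1` _ = [set om | (forall m, (m <= n)%N -> T om m = t m) /\
   add_child (tset a) (T om n.+1) u]); last first.
  apply/seteqP; split=> om /=; rewrite sa.
    by move=> [_ _ /followsE].
  by move=> [/followsE ? ?].
rewrite H; congr (P _ * _)%E.
by apply/seteqP; split=> om /=; [move=> /followsE|move=> [_ _ /followsE]].
Qed.

(** All labelled histories of the shorter shape have the same transition probability at the node in
    the place of [v], so it factors out of their disjoint union. The resulting event is included in
    the longer relabelled history, whence the inequality. *)
Lemma preferential_attachment_lower_bound n w : w \in canonical_histories n ->
  ((weight R w)%:E <= P (T @^-1` relabelled_history w))%E.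
Proof.
elim: n w => [|n IH] w /=.
  rewrite inE => /eqP->; rewrite (_ : _ @^-1` _ = setT).
    rewrite probability_setT lee_fin /weight big_seq1 big_ord0 /deg /sibs /=.
    by rewrite invr1 mulr1.
  apply/seteqP; split=> // om _; exists [:: root]; split => //; first by left.
  move=> [|//] _; rewrite PA.1.
  by apply/fsetP => x; rewrite in_tset !inE.
move=> /allpairsPdep[w' [v [wn vw ->]]].
rewrite (weight_rcons _ wn)// EFinM.
apply: (@le_trans _ _ (P (T @^-1` \bigcup_i F' w' v i))).
  rewrite preimage_bigcup.
  rewrite (measure_bigcup_scale (mF w') (mF' w' v) (@tF w') (@tF' w' v) (fun i => PF' i wn vw)).
  rewrite -preimage_bigcup -relabelled_historyE.
  by apply: lee_wpmul2r; [rewrite lee_fin divr_ge0|exact: IH].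
apply: le_measure; rewrite ?inE.
- by rewrite preimage_bigcup; exact: bigcup_measurable.
- apply: (@measurable_finitely_determinedT n.+2) => x y xy [a [ha aw ax]].
  exists a; split => //; apply: followsW xy _ ax.
  by rewrite -(size_map (relab a)) -[map _ _]/(canon a) aw size_rcons (size_canonical wn).
move=> om [i _]; rewrite /F' /=; case: choice.pickle_inv => // a [ha aw ax [j ja tE]].
have sa : size a = n.+1 by rewrite -(size_canonical wn) -aw size_map.
have iw : (index v w' < size a)%N by rewrite sa -(size_canonical wn) index_mem.
set u := nth root a (index v w') in ja tE.
have ua : u \in a by rewrite mem_nth.
have uv : relab a u = v by rewrite /u -(nth_map _ root)// -[map _ _]/(canon a) aw nth_index.
rewrite in_tset in ja.
exists (rcons a (rcons u j)); split.
- by right.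
- by rewrite canon_rcons// aw uv -(deg_canon ha ua) aw uv.
- exact: follows_rcons.
Qed.

End preferential_attachment_lower_bound.

(** * Upper bound for split trees *)

Section subtree_sizes.
Variables (w : seq node).
Hypothesis hw : history w.
Let uw := history_uniq hw.

Definition subtree_size (x : node) : nat := count (prefix x) w.

(** Every non-root node is the child of exactly one node of [w]. *)
Lemma big_sibs (S : Type) (idx : S) (op : Monoid.com_law idx) (G : node -> S) :
  \big[op/idx]_(v <- w) \big[op/idx]_(c <- sibs w v) G c =
  \big[op/idx]_(c <- w | c != root) G c.
Proof.
under eq_bigr do rewrite big_filter.
rewrite (exchange_big_dep (fun c => c != root))/=; last by move=> v c _ /andP[].
rewrite big_seq_cond [RHS]big_seq_cond; apply: eq_bigr => c /andP[cw c0].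
rewrite c0 /= -big_filter (eq_filter (a2 := pred1 (parent c))); last first.
  by move=> v; rewrite /= eq_sym.
by rewrite filter_pred1_uniq// ?history_take// big_seq1.
Qed.

Lemma perm_prefixes x : x \in w ->
  perm_eq [seq take l.+1 x | l <- iota 0 (size x)]
          [seq c <- w | (c != root) && prefix c x].
Proof.
move=> xw; apply: uniq_perm; rewrite ?filter_uniq//.
  rewrite map_inj_in_uniq ?iota_uniq// => i j.
  rewrite !mem_iota !add0n => /= ix jx /(congr1 size).
  by rewrite !size_takel// => -[].
move=> c; rewrite mem_filter; apply/mapP/andP.
  move=> [l]; rewrite mem_iota add0n => /= lx ->.
  by rewrite history_take// -size_eq0 size_takel// prefixE size_takel// eqxx.
move=> [/andP[c0 pcx] cw].
have /eqP cx : take (size c) x == c by rewrite -prefixE.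
have sc : (0 < size c)%N by case: (c) c0.
exists (size c).-1; last by rewrite prednK.
by rewrite mem_iota add0n /= prednK// size_prefix.
Qed.

Lemma subtree_size_gt0 x : x \in w -> (0 < subtree_size x)%N.
Proof. by move=> xw; rewrite -has_count; apply/hasP; exists x => //; exact: prefix_refl. Qed.

Lemma subtree_size_root : subtree_size root = size w.
Proof. by rewrite /subtree_size -[RHS](count_predT w); apply: eq_count => x; rewrite prefix0s. Qed.

(** The successor accounts for [v] itself; any other [x] below [v] lies below exactly one child,
    [take (size v).+1 x]. *)
Lemma subtree_size_sibs v : v \in w ->
  subtree_size v = (\sum_(c <- sibs w v) subtree_size c).+1.
Proof.
move=> vw; rewrite /subtree_size.
under eq_bigr do rewrite -sum1_count big_mkcond.
rewrite exchange_big/= -addn1.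
have E1 : (1 = \sum_(x <- w) (x == v))%N.
  rewrite (big_rem v)//= eqxx big1_seq// => u /=.
  by rewrite mem_rem_uniq// inE => /andP[/negPf->].
rewrite [X in _ = (_ + X)%N]E1 -big_split/= -sum1_count big_mkcond/=; apply: eq_big_seq => x xw.
rewrite -big_mkcond/= sum1_count.
have [->|xv] := eqVneq x v.
  rewrite prefix_refl [X in (X + _)%N](_ : _ = 0%N)//.
  apply/eqP; rewrite -leqn0 leqNgt -has_count; apply/hasPn => c.
  rewrite mem_filter => /andP[/andP[c0 /eqP cv] cw]; apply/negP => /size_prefix.
  rewrite -cv size_parent; case: (c) c0 => // y s _ /=; by rewrite ltnn.
rewrite addn0; case: ifPn => pvx.
  have svx : (size v < size x)%N.
    rewrite ltn_neqAle size_prefix// andbT; apply: contraNN xv => /eqP sv.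
    by move: pvx; rewrite prefixE sv take_size.
  have cin : take (size v).+1 x \in sibs w v.
    rewrite mem_filter history_take// -size_eq0 size_takel//= andbT.
    by rewrite /parent size_takel// take_takel//=; rewrite prefixE in pvx.
  rewrite -(_ : count_mem (take (size v).+1 x) (sibs w v) = 1%N).
    apply: eq_in_count => c; rewrite mem_filter => /andP[/andP[c0 /eqP cv] _].
    have sc : size c = (size v).+1 by rewrite -cv size_parent prednK//; case: (c) c0.
    by rewrite /= prefixE sc eq_sym.
  by rewrite count_uniq_mem ?filter_uniq// cin.
apply/esym/eqP; rewrite -leqn0 leqNgt -has_count; apply/hasPn => c.
rewrite mem_filter => /andP[/andP[c0 /eqP cv] cw]; apply: contraNN pvx.
rewrite -cv; apply: prefix_trans; exact: prefix_take.
Qed.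

(* [l] indexes the steps of the path from the root to [x]; every non-root node
   [c] is a step of the paths to the nodes of its subtree. *)
Lemma prod_paths (S : comPzRingType) (f : node -> nat -> S) :
  \prod_(x <- w) \prod_(l <- iota 0 (size x)) f (take l x) (nth 0%N x l) =
  \prod_(v <- w) \prod_(c <- sibs w v) f v (last 0%N c) ^+ subtree_size c.
Proof.
pose H c := f (parent c) (last 0%N c).
transitivity (\prod_(v <- w) \prod_(c <- sibs w v) H c ^+ subtree_size c); last first.
  apply: eq_bigr => v _; apply: eq_big_seq => c.
  by rewrite mem_filter => /andP[/andP[_ /eqP<-]].
rewrite (@big_sibs _ _ *%R).
transitivity (\prod_(x <- w) \prod_(c <- w | (c != root) && prefix c x) H c).
  apply: eq_big_seq => x xw.
  rewrite -[RHS]big_filter -(perm_big _ (perm_prefixes xw)) big_map.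
  apply: eq_big_seq => l; rewrite mem_iota add0n => /= lx.
  rewrite /H /parent size_takel//= take_takel//.
  by rewrite (last_nth 0%N) size_takel// /= nth_take//; case: (x) lx.
rewrite (exchange_big_dep (fun c => c != root))/=; last by move=> v c _ /andP[].
apply: eq_bigr => c c0.
rewrite big_const_seq iter_mulr_1; congr (_ ^+ _).
by apply: eq_count => x; rewrite /= c0.
Qed.

End subtree_sizes.

Section eppf_of_history.
Context (R : realType).

(** The double factorial (2n - 1)!!, that is, 2^n times the rising factorial of 1/2. *)
Let D n : R := \prod_(r < n) (r.*2.+1)%:R.

Let D_neq0 n : D n != 0.
Proof. by apply/prodf_neq0 => i _; rewrite pnatr_eq0. Qed.

Let rising_half n : rising (2^-1 : R) n = D n / 2 ^+ n.
Proof.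
elim: n => [|n IH]; first by rewrite rising0 /D big_ord0 expr0 divr1.
rewrite risingS IH /D big_ord_recr/= exprSr invfM mulrACA; congr (_ * _).
have -> : (n.*2.+1)%:R = n%:R * 2 + 1 :> R by rewrite -muln2 -addn1 natrD natrM.
by field.
Qed.

(** For k blocks of total size n the powers of 2 cancel: 2^(-k) from the first product, 2^(k - n)
    from the blocks, 2^n from the denominator. *)
Lemma eppf_half (ns : seq nat) : all (fun n => 0 < n)%N ns ->
  eppf (2^-1 : R) 2^-1 ns =
  (size ns)`!%:R * \prod_(n <- ns) D n.-1 / D (sumn ns).
Proof.
move=> ns0; rewrite /eppf.
have -> : 1 - 2^-1 = 2^-1 :> R by field.
have -> : \prod_(i < size ns) (2^-1 + i%:R * 2^-1) =
    (size ns)`!%:R / 2 ^+ size ns :> R.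
  elim: (size ns) => [|k IH]; first by rewrite big_ord0 expr0 divr1.
  by rewrite big_ord_recr/= IH factS natrM exprS -[k.+1%:R]natr1; field; rewrite expf_neq0.
have -> : \prod_(n <- ns) rising (2^-1 : R) n.-1 =
    \prod_(n <- ns) D n.-1 * 2 ^+ size ns / 2 ^+ sumn ns.
  elim: ns ns0 => [|n ns IH] /=; first by rewrite !big_nil !expr0 divr1 mulr1.
  case: n => // n /IH E; rewrite !big_cons E /= rising_half exprS exprD exprS.
  by field; rewrite !expf_neq0 ?pnatr_eq0.
rewrite rising_half.
by field; rewrite D_neq0 !expf_neq0 ?pnatr_eq0.
Qed.

(** For c other than the root, [D (subtree_size w c).-1] is a numerator at the parent of c and the
    denominator at c; only the denominator at the root survives. *)
Lemma prod_eppf_history n w : w \in canonical_histories n ->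
  \prod_(v <- w) eppf (2^-1 : R) 2^-1 [seq subtree_size w c | c <- sibs w v] =
  weight R w.
Proof.
move=> wn; have [hw _] := canonicalP wn.
have st0 c : c \in w -> (0 < subtree_size w c)%N by exact: subtree_size_gt0.
transitivity (\prod_(v <- w) (((deg w v)`!)%:R *
    \prod_(c <- sibs w v) D (subtree_size w c).-1 * (D (subtree_size w v).-1)^-1)).
  apply: eq_big_seq => v vw; rewrite eppf_half.
    rewrite size_map big_map (subtree_size_sibs hw vw) /=.
    by congr (_ * _ / D _); rewrite sumnE big_map.
  apply/allP => _ /mapP[c + ->]; rewrite mem_filter => /andP[_]; exact: st0.
rewrite !big_split/= (@big_sibs _ hw _ _ *%R).
have -> : \prod_(v <- w) (D (subtree_size w v).-1)^-1 =
    (D (size w).-1)^-1 * \prod_(c <- w | c != root) (D (subtree_size w c).-1)^-1.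
  rewrite (bigID (pred1 root))/=; congr (_ * _).
  rewrite -big_filter filter_pred1_uniq ?history_uniq ?history_root_in//.
  by rewrite big_seq1 subtree_size_root.
rewrite prodfV /weight natr_prod -/(D _); field.
by rewrite D_neq0 prodf_seq_neq0; apply/allP => c _; rewrite D_neq0 implybT.
Qed.

End eppf_of_history.

Section arrangements.

Fixpoint arrangements (k : nat) (L : seq nat) : seq (seq nat) :=
  if k is k'.+1 then [seq l :: s | l <- L, s <- arrangements k' (rem l L)]
  else [:: [::]].

Lemma mem_arrangements k L s : uniq L ->
  (s \in arrangements k L) = [&& uniq s, all (mem L) s & size s == k].
Proof.
elim: k L s => [|k IH] L [|l s] uL //=.
- by rewrite inE !andbF.
- by apply/negP => /allpairsPdep[l [s [_ _]]].
- rewrite eqSS; apply/allpairsPdep/and3P => [[m [r [mL rs [-> ->]]]]|].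
    move: rs; rewrite IH ?rem_uniq// => /and3P[-> /allP rL ->]; split=> //.
      rewrite andbT; apply/negP => /rL; rewrite /= mem_rem_uniq// inE eqxx.
      by [].
    apply/andP; split => //; apply/allP => x /rL.
    by rewrite /= mem_rem_uniq// inE => /andP[].
  move=> [/andP[ls us] /andP[lL /allP sL] sk]; exists l, s; split => //.
  rewrite IH ?rem_uniq// us sk andbT /=; apply/allP => x xs.
  have /= xL := sL x xs; rewrite /= mem_rem_uniq// inE xL andbT.
  by apply: contraNneq ls => <-.
Qed.

Definition monomial (R : realType) (s ns : seq nat) (x : nat -> R) : R :=
  \prod_(p <- zip s ns) `|x p.1| ^+ p.2.

Lemma arrangement_sumE (R : realType) ns L (x : nat -> R) :
  arrangement_sum ns L x = \sum_(s <- arrangements (size ns) L) monomial s ns x.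
Proof.
elim: ns L => [|n ns IH] L /=; first by rewrite big_seq1 /monomial big_nil.
rewrite big_allpairs_dep/=; apply: eq_bigr => l _.
rewrite IH mulr_sumr; apply: eq_bigr => s _.
by rewrite /monomial /= big_cons.
Qed.

Context (A : node -> seq (seq nat)).

(** A family [F] encodes the function sending [v] to [nth [::] F (index v vs)]; families index the
    expansion of a product of sums. *)
Fixpoint families (vs : seq node) : seq (seq (seq nat)) :=
  if vs is v :: vs' then [seq s :: F | s <- A v, F <- families vs'] else [:: [::]].

Lemma sum_families (R : realType) (vs : seq node) (f : node -> seq nat -> R) :
  \sum_(F <- families vs) \prod_(p <- zip vs F) f p.1 p.2 =
  \prod_(v <- vs) \sum_(s <- A v) f v s.
Proof.
elim: vs => [|v vs IH] /=; first by rewrite big_seq1 !big_nil.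
rewrite big_allpairs_dep/= big_cons -IH mulr_suml; apply: eq_bigr => s _.
by rewrite mulr_sumr; apply: eq_bigr => F _; rewrite big_cons.
Qed.

Lemma mem_families (vs : seq node) F : uniq vs ->
  (F \in families vs) =
  (size F == size vs) && all (fun v => nth [::] F (index v vs) \in A v) vs.
Proof.
elim: vs F => [|v vs IH] [|s F] //=.
  by move=> _; apply/negP => /allpairsPdep[s [F [_ _]]].
move=> /andP[vvs uvs]; rewrite eqxx /= eqSS.
have -> : all (fun u => nth [::] (s :: F) (if v == u then 0%N else (index u vs).+1) \in A u) vs
    = all (fun u => nth [::] F (index u vs) \in A u) vs.
  apply: eq_in_all => u uvs'; case: eqP => // vu; by rewrite vu uvs' in vvs.
rewrite andbCA -IH//; apply/allpairsPdep/andP.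
  by move=> [s' [F' [? ? [-> ->]]]].
by move=> [? ?]; exists s, F.
Qed.

Lemma prod_zip_index (R : realType) (vs : seq node) F (f : node -> seq nat -> R) :
  uniq vs -> size F = size vs ->
  \prod_(p <- zip vs F) f p.1 p.2 = \prod_(v <- vs) f v (nth [::] F (index v vs)).
Proof.
elim: vs F => [|v vs IH] [|s F] //=; first by rewrite !big_nil.
move=> /andP[vvs uvs] [sF]; rewrite !big_cons eqxx IH//; congr (_ * _).
apply: eq_big_seq => u uvs'; case: eqP => // vu; by rewrite vu uvs' in vvs.
Qed.

End arrangements.

Section labellings.
Variables (w : seq node) (F : seq (seq nat)).

(* The original label of the [i]-th born child of [v]. *)
Definition family_label v i : nat := nth 0%N (nth [::] F (index v w)) i.

(** The inverse of [relab] once the labels are known: birth ranks along the path to [x] become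
    labels again. *)
Definition labelling (x : node) : node :=
  mkseq (fun l => family_label (take l x) (nth 0%N x l)) (size x).

Lemma size_labelling x : size (labelling x) = size x.
Proof. exact: size_mkseq. Qed.

Lemma take_labelling l x : take l (labelling x) = labelling (take l x).
Proof.
apply: (@eq_from_nth _ 0%N).
  by rewrite size_take size_labelling size_labelling size_take.
move=> i; rewrite size_take_min leq_min size_labelling => /andP[il ix].
rewrite nth_take// !nth_mkseq ?size_take_min ?leq_min ?il//.
by rewrite nth_take// take_takel// ltnW.
Qed.

Lemma nth_labelling l x : (l < size x)%N ->
  nth 0%N (labelling x) l = family_label (take l x) (nth 0%N x l).
Proof. by move=> lx; rewrite nth_mkseq. Qed.

Hypothesis hw : history w.
Hypothesis sibsw : forall v, sibs w v = [seq rcons v i | i <- iota 0 (deg w v)].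
Hypothesis famF :
  forall v, v \in w -> let s := nth [::] F (index v w) in uniq s && (size s == deg w v).

(** Ensures that the nodes of [w] stand for distinct labelled nodes, whose vectors are
    independent. *)
Lemma labelling_inj : {in w &, injective labelling}.
Proof.
move=> x; have [n] := ubnP (size x); elim: n x => // n IH x sx y xw yw xy.
have sxy : size x = size y by rewrite -(size_labelling x) xy size_labelling.
case/lastP: x => [|x i] in sx xw xy sxy *; first by case: y sxy {xy yw}.
case/lastP: y => [|y j] in yw xy sxy *; first by rewrite size_rcons in sxy.
rewrite !size_rcons in sx sxy; case: sxy => sxy.
have xw' : x \in w by have := history_take (size x) hw xw; rewrite -cats1 take_size_cat.
have yw' : y \in w by have := history_take (size y) hw yw; rewrite -cats1 take_size_cat.
have lab_rcons v k : labelling (rcons v k) = rcons (labelling v) (family_label v k).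
  rewrite /labelling size_rcons mkseqS -(cats1 v) take_size_cat// nth_cat ltnn subnn/=.
  congr rcons; apply/eq_in_map => l; rewrite mem_iota add0n => /= lv.
  by rewrite takel_cat 1?ltnW// nth_cat lv.
move: xy; rewrite !lab_rcons => /rcons_inj[xy ij].
have exy : x = y by exact: IH.
subst y; congr rcons; move: ij; rewrite /family_label.
have /andP[us /eqP sz] := famF xw'.
have ltdeg k : rcons x k \in w -> (k < deg w x)%N.
  move=> kw; have : rcons x k \in sibs w x.
    by rewrite mem_filter rcons_neq_root parent_rcons eqxx.
  by rewrite sibsw => /mapP[k']; rewrite mem_iota add0n => /= k'd /rcons_inj[->].
by move=> /eqP; rewrite nth_uniq ?sz ?ltdeg// => /eqP.
Qed.

End labellings.

Section covering.
Variables (h : seq node).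
Hypothesis hh : history h.

(** The labels that [canon] erases, node by node; positions in [h] and in [canon h] agree. *)
Definition label_family : seq (seq nat) :=
  [seq [seq last 0%N c | c <- sibs h v] | v <- h].

Lemma nth_sibs_rank u : u \in h -> u != root ->
  nth root (sibs h (parent u)) (rank h u) = u.
Proof.
move=> uh u0; rewrite -{1}(cat_take_drop (index u h) h) sibs_cat nth_cat ltnn subnn.
by rewrite (drop_nth root) ?index_mem// nth_index// /sibs /= u0 eqxx.
Qed.

Lemma nth_label_family x : x \in h ->
  nth [::] label_family (index (relab h x) (canon h)) =
  [seq last 0%N c | c <- sibs h x].
Proof.
move=> xh; rewrite (nth_map root); last first.
  by rewrite -(size_map (relab h)) index_mem map_f.
by rewrite nth_index_map//; exact: relab_inj.
Qed.

Lemma labelling_relab x : x \in h ->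
  labelling (canon h) label_family (relab h x) = x.
Proof.
move=> xh; apply: (@eq_from_nth _ 0%N); first by rewrite size_labelling size_relab.
move=> l; rewrite size_labelling size_relab => lx.
rewrite nth_labelling ?size_relab// /family_label.
have tE : take l (relab h x) = relab h (take l x).
  apply: (@eq_from_nth _ 0%N); first by rewrite size_relab !size_take size_relab.
  move=> i; rewrite size_take_min size_relab leq_min => /andP[il ix].
  rewrite nth_take// !nth_mkseq ?size_take_min ?leq_min ?il//.
  by rewrite take_takel.
rewrite tE nth_label_family ?history_take// nth_mkseq//.
have uh : take l.+1 x \in h by exact: history_take.
have u0 : take l.+1 x != root by rewrite -size_eq0 size_takel.
have pu : parent (take l.+1 x) = take l x by rewrite /parent size_takel// take_takel.
rewrite (nth_map root); last first.
  rewrite -pu ltnNge; apply/negP => H; have := nth_sibs_rank uh u0.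
  by rewrite nth_default// => E; rewrite -E eqxx in u0.
rewrite -pu nth_sibs_rank//.
by rewrite (last_nth 0%N) size_takel// /= nth_take//; case: (x) lx.
Qed.

Lemma label_family_arrangements (M : nat) :
  (forall v, v \in h -> forall i, i \in v -> (i < M)%N) ->
  label_family \in
    families (fun v => arrangements (deg (canon h) v) (iota 0 M)) (canon h).
Proof.
move=> hM.
have uc : uniq (canon h) by rewrite map_inj_in_uniq ?history_uniq//; exact: relab_inj.
rewrite mem_families// !size_map eqxx /=; apply/allP => _ /mapP[x xh ->].
rewrite mem_arrangements ?iota_uniq// nth_label_family// deg_canon// size_map eqxx andbT.
apply/andP; split.
  rewrite map_inj_in_uniq ?filter_uniq ?history_uniq// => u v.
  rewrite !mem_filter => /andP[/andP[u0 /eqP pu] _] /andP[/andP[v0 /eqP pv] _].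
  have [i ui] := rcons_parent u0; have [j vj] := rcons_parent v0.
  by rewrite ui vj pu pv !last_rcons => ->.
apply/allP => _ /mapP[u + ->]; rewrite mem_filter => /andP[/andP[u0 _] uh].
rewrite /= mem_iota add0n; apply: hM uh _ _.
by have [i ->] := rcons_parent u0; rewrite last_rcons mem_rcons mem_head.
Qed.

End covering.

Lemma monomial_ge0 (R : realType) s ns (x : nat -> R) : 0 <= monomial s ns x.
Proof. by apply: prodr_ge0 => p _; rewrite exprn_ge0. Qed.

Lemma measurable_monomial (R : realType) s ns :
  measurable_fun [set: seq_space R] (monomial s ns : seq_space R -> R).
Proof.
apply: measurable_prod => p _; apply: measurable_funX.
apply: measurableT_comp; first exact: normr_measurable.
exact: measurable_coordinate.
Qed.

Lemma le_measure_bigsetU_seq d (Om : measurableType d) (R : realType)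
    (P : {measure set Om -> \bar R}) (I : Type) (s : seq I) (A : I -> set Om) :
  (forall i, measurable (A i)) ->
  (P (\big[setU/set0]_(i <- s) A i) <= \sum_(i <- s) P (A i))%E.
Proof.
move=> mA; elim: s => [|i s IH]; first by rewrite !big_nil measure0.
rewrite !big_cons.
apply: (@le_trans _ _ (P (A i) + P (\big[setU/set0]_(j <- s) A j))%E).
  by apply: measureU2 => //; exact: bigsetU_measurable.
by rewrite leeD2l.
Qed.

Section split_tree_upper_bound.
Context (R : realType) (mu : probability (seq_space R) R).
Hypothesis muP : forall M ns, all (fun n => 0 < n)%N ns ->
  (\int[mu]_x (arrangement_sum ns (iota 0 M) x)%:E <=
   (eppf (2^-1 : R) 2^-1 ns)%:E)%E.
Context d (Om : measurableType d) (P : probability Om R).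
Variables (V : node -> {RV P >-> seq_space R}) (C : nat * node -> {RV P >-> nat}).
Hypothesis model : split_tree_model mu V C.

Section one_history.
Variables (n : nat) (w : seq node).
Hypothesis wn : w \in canonical_histories n.
Let hw := (canonicalP wn).1.
Let sw := (canonicalP wn).2.
Let uw := history_uniq hw.

Let ns v := [seq subtree_size w c | c <- sibs w v].

Let ns_gt0 v : all (fun n => 0 < n)%N (ns v).
Proof.
apply/allP => _ /mapP[c + ->]; rewrite mem_filter => /andP[_].
exact: subtree_size_gt0.
Qed.

Let size_ns v : size (ns v) = deg w v.
Proof. by rewrite size_map. Qed.

Let arr M v := arrangements (deg w v) (iota 0 M).

Let coef v s : R := fine (\int[mu]_x (monomial s (ns v) x)%:E)%E.

Let mmon s v : measurable_fun [set: seq_space R]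
  (fun x : seq_space R => (monomial s (ns v) x)%:E).
Proof. by apply/measurable_EFinP; exact: measurable_monomial. Qed.

Let sum_monomials M v : (\sum_(s <- arr M v) \int[mu]_x (monomial s (ns v) x)%:E <=
  (eppf (2^-1 : R) 2^-1 (ns v))%:E)%E.
Proof.
apply: le_trans (muP M (ns_gt0 v)).
rewrite -ge0_integral_sum//; last first.
  by move=> s x _; rewrite lee_fin monomial_ge0.
rewrite le_eqVlt; apply/orP; left; apply/eqP; apply: eq_integral => x _.
by rewrite sumEFin arrangement_sumE size_ns.
Qed.

(** The integral is finite as a term of a nonnegative sum bounded by [eppf]. *)
Let coefE M v s : s \in arr M v ->
  (\int[mu]_x (monomial s (ns v) x)%:E = (coef v s)%:E)%E.
Proof.
move=> sM; rewrite fineK// ge0_fin_numE; last first.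
  by apply: integral_ge0 => x _; rewrite lee_fin monomial_ge0.
apply: le_lt_trans (ltry (eppf (2^-1 : R) 2^-1 (ns v))).
apply: le_trans (sum_monomials M v).
rewrite (big_rem s)//= leeDl// sume_ge0// => s' _.
by apply: integral_ge0 => x _; rewrite lee_fin monomial_ge0.
Qed.

Let sum_coef M v : \sum_(s <- arr M v) coef v s <= eppf (2^-1 : R) 2^-1 (ns v).
Proof.
rewrite -lee_fin -sumEFin; apply: le_trans (sum_monomials M v).
rewrite le_eqVlt; apply/orP; left; apply/eqP.
by apply: eq_big_seq => s /coefE.
Qed.

Let coef_ge0 v s : 0 <= coef v s.
Proof.
by apply: fine_ge0; apply: integral_ge0 => x _; rewrite lee_fin monomial_ge0.
Qed.

(** The choices that balls 0, ..., [n] consult if the labels are those of [F]: ball [k] passes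
    through the proper ancestors of its final node. *)
Let keys F := [seq (k, take l (labelling w F (nth root w k))) |
  k <- iota 0 n.+1, l <- iota 0 (size (nth root w k))].

(** At an ancestor of depth l the ball must choose letter l of its final node. *)
Let choice F (key : nat * node) : nat :=
  nth 0%N (labelling w F (nth root w key.1)) (size key.2).

Let Ev F : set Om :=
  \bigcap_(key in [set` keys F]) C key @^-1` [set choice F key].

Let mEv F : measurable (Ev F).
Proof.
apply: fin_bigcap_measurable => // key _.
by rewrite -[X in measurable X]setTI; exact: measurable_funPT.
Qed.

Let uniq_keys F : uniq (keys F).
Proof.
apply: allpairs_uniq_dep; rewrite ?iota_uniq//.
  by move=> k _; exact: iota_uniq.
move=> [k l] [k' l'] /allpairsPdep[k1 [l1 [_ + [-> ->]]]] /allpairsPdep[k2 [l2 [_ + [-> ->]]]].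
rewrite !mem_iota !add0n => /= l1s l2s [k12]; rewrite -k12 in l2s *.
by move/(congr1 size); rewrite !size_takel ?size_labelling; [move=> ->|exact: ltnW|exact: ltnW].
Qed.

Section one_family.
Variables (M : nat) (F : seq (seq nat)).
Hypothesis FM : F \in families (arr M) w.

Let Fv v := nth [::] F (index v w).
Let lab := labelling w F.

Let FvP v : v \in w -> Fv v \in arr M v.
Proof. by move: FM; rewrite mem_families// => /andP[_ /allP]; apply. Qed.

Let uniq_Fv v : v \in w -> uniq (Fv v) && (size (Fv v) == deg w v).
Proof.
by move=> /FvP; rewrite mem_arrangements ?iota_uniq// => /and3P[-> _ ->].
Qed.

Let lab_inj : {in w &, injective lab}.
Proof. exact: labelling_inj hw sw uniq_Fv. Qed.

(** Regroups the choices by the node where they are made: by [prod_paths], the edge to a child is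
    crossed once for each node of the subtree below it. *)
Let prod_keys om :
  \prod_(key <- keys F) `|V key.2 om (choice F key)| =
  \prod_(v <- w) monomial (Fv v) (ns v) (V (lab v) om).
Proof.
rewrite /keys big_allpairs_dep/=.
pose g v i := `|V (lab v) om (family_label w F v i)|.
transitivity (\prod_(x <- w) \prod_(l <- iota 0 (size x)) g (take l x) (nth 0%N x l)).
  rewrite -[in RHS](mkseq_nth root w) big_map (size_canonical wn).
  apply: eq_bigr => k _; apply: eq_big_seq => l; rewrite mem_iota add0n => /= lk.
  rewrite /g /choice /= take_labelling size_labelling size_takel 1?ltnW//.
  by rewrite nth_labelling.
rewrite prod_paths//; apply: eq_big_seq => v vw.
have /andP[_ /eqP sF] := uniq_Fv vw.
rewrite /monomial /ns sw big_map -{1}(mkseq_nth 0%N (Fv v)) sF -map_comp zip_map.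
rewrite big_map; apply: eq_bigr => i _.
by rewrite /= last_rcons.
Qed.

Lemma choices_upper_bound : (P (Ev F) <= (\prod_(v <- w) coef v (Fv v))%:E)%E.
Proof.
have [Vmu indepV condC] := model.
have [_ condP] := condC (keys F) (choice F) (uniq_keys F).
(* The conditional probability, integrated over the whole space, gives the probability of [Ev F]. *)
have GT : generated_sigma V setT.
  by rewrite /generated_sigma -[X in _ X]setD0; apply: sigma_algebraCD; exact: sigma_algebra0.
have := condP setT GT; rewrite setTI => ->.
(* Independence is indexed by labelled nodes, the monomials by nodes of [w]; [inv] inverts [lab],
   with the default [root] off its image. *)
pose inv y := nth root w (index y [seq lab v | v <- w]).
have invK v : v \in w -> inv (lab v) = v by move=> vw; rewrite /inv nth_index_map.
pose f y (x : seq_space R) : R := monomial (Fv (inv y)) (ns (inv y)) x.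
pose c y : R := coef (inv y) (Fv (inv y)).
have us : uniq [seq lab v | v <- w] by rewrite map_inj_in_uniq.
have mf y : measurable_fun [set: seq_space R] (f y) by exact: measurable_monomial.
have f0 y x : 0 <= f y x by exact: monomial_ge0.
have Ef y : y \in [seq lab v | v <- w] -> (\int[P]_om (f y (V y om))%:E = (c y)%:E)%E.
  move=> /mapP[v vw ->]; rewrite /f /c invK// -(coefE (FvP vw)).
  rewrite -(ge0_integral_distribution (V (lab v)) (mmon (Fv v) v)); last first.
    by move=> x; rewrite lee_fin monomial_ge0.
  by apply: eq_measure_integral => A mA _; exact: Vmu.
have := integral_prod_independent indepV mf f0 us Ef.
rewrite !big_map.
have -> : \prod_(v <- w) c (lab v) = \prod_(v <- w) coef v (Fv v).
  by apply: eq_big_seq => v vw; rewrite /c invK.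
move=> <-.
apply: (@le_trans _ _ (\int[P]_om
    (\prod_(key <- keys F) `|V key.2 om (choice F key)|)%:E)%E); last first.
  rewrite le_eqVlt; apply/orP; left; apply/eqP; apply: eq_integral => om _.
  congr EFin; rewrite prod_keys big_map; apply: eq_big_seq => v vw.
  by rewrite /f invK.
apply: le_trans (lee_abs _) _.
have mV : measurable_fun [set: Om]
    (fun om => (\prod_(key <- keys F) V key.2 om (choice F key))%:E).
  apply/measurable_EFinP; apply: measurable_prod => key _.
  exact: (measurableT_comp (measurable_coordinate (choice F key))).
apply: le_trans (le_abse_integral P measurableT mV) _.
rewrite le_eqVlt; apply/orP; left; apply/eqP; apply: eq_integral => om _.
by rewrite abse_EFin normr_prod.
Qed.

End one_family.

(** A union bound over the families, whose sum then factorizes into one sum per node. *)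
Lemma families_upper_bound M :
  (P (\big[setU/set0]_(F <- families (arr M) w) Ev F) <= (weight R w)%:E)%E.
Proof.
apply: le_trans (le_measure_bigsetU_seq _ _ _) _ => //.
apply: (@le_trans _ _ (\sum_(F <- families (arr M) w)
   (\prod_(v <- w) coef v (nth [::] F (index v w)))%:E)%E).
  rewrite big_seq [leRHS]big_seq; apply: lee_sum => F; exact: choices_upper_bound.
rewrite sumEFin lee_fin -(prod_eppf_history R wn).
have -> : \sum_(F <- families (arr M) w) \prod_(v <- w) coef v (nth [::] F (index v w)) =
    \sum_(F <- families (arr M) w) \prod_(p <- zip w F) coef p.1 p.2.
  apply: eq_big_seq => F; rewrite mem_families// => /andP[/eqP sF _].
  by rewrite prod_zip_index.
rewrite (sum_families (arr M) w coef).
rewrite [leLHS]big_seq [leRHS]big_seq; apply: ler_prod => v vw.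
by rewrite sum_coef sumr_ge0.
Qed.

Let nondecreasing_families (M M' : nat) F : (M <= M')%N ->
  F \in families (arr M) w -> F \in families (arr M') w.
Proof.
move=> MM'; rewrite !mem_families// => /andP[-> /allP FM]; apply/allP => v vw.
have := FM v vw; rewrite !mem_arrangements ?iota_uniq// => /and3P[-> /allP sM ->].
rewrite andbT; apply/allP => x /sM; rewrite /= !mem_iota !add0n => /leq_trans; exact.
Qed.

Let Y M : set Om := \big[setU/set0]_(F <- families (arr M) w) Ev F.

Let YE M om : Y M om <-> exists2 F, F \in families (arr M) w & Ev F om.
Proof.
rewrite /Y -bigcup_seq; split; first by move=> [F FM ?]; exists F.
by move=> [F FM ?]; exists F.
Qed.

(** The labels of the first [n.+1] nodes are finite but not bounded in advance, so the event is
    covered by the increasing union of the [Y M], where the labels lie below [M]. *)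
Lemma canonical_history_upper_bound :
  measurable [set om | canon (balls (fun key => C key om) n.+1) = w] ->
  (P [set om | canon (balls (fun key => C key om) n.+1) = w] <= (weight R w)%:E)%E.
Proof.
move=> mX.
have mY M : measurable (Y M) by exact: bigsetU_measurable.
have ndY : {homo Y : M M' / (M <= M')%N >-> (M <= M')%O}.
  move=> M M' MM'; rewrite subsetEset => om /YE[F FM EF].
  by apply/YE; exists F => //; exact: nondecreasing_families FM.
have mUY : measurable (\bigcup_M Y M) by exact: bigcup_measurable.
apply: (@le_trans _ _ (P (\bigcup_M Y M))).
  apply: le_measure; rewrite ?inE// => om /= cw.
  set h := balls (fun key => C key om) n.+1 in cw.
  have hh : history h by exact: history_balls.
  pose M := (\max_(v <- h) \max_(i <- v) i).+1.
  exists M => //; apply/YE; exists (label_family h).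
    rewrite /arr -cw; apply: label_family_arrangements => // v vh i iv.
    rewrite ltnS; apply: (@leq_trans (\max_(j <- v) j)); first exact: leq_bigmax_seq.
    exact: (@leq_bigmax_seq node h xpredT (fun u : node => \max_(j <- u) j) v vh isT).
  move=> _ /allpairsPdep[k [l [+ + ->]]].
  rewrite !mem_iota !add0n => /= kn lk.
  (* The family read off from [h] gives back the final node of ball [k]; each letter of it was
     chosen on the way, by [ball_path]. *)
  have kE : labelling w (label_family h) (nth root w k) = ball (fun key => C key om) k.
    have -> : nth root w k = relab h (nth root h k).
      by rewrite -cw (nth_map root)// size_mkseq.
    rewrite -cw labelling_relab//; first by rewrite nth_mkseq.
    by rewrite mem_nth// size_mkseq.
  rewrite /choice /= kE -kE size_takel ?size_labelling 1?ltnW//.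
  have lb : (l < size (ball (fun key => C key om) k))%N by rewrite -kE size_labelling.
  by rewrite kE; have [_ ->] := ball_path lb.
have cvY : P (Y M) @[M --> \oo] --> P (\bigcup_M Y M) by exact: nondecreasing_cvg_mu.
apply: (@le_trans _ _ (limn (fun M => P (Y M)))).
  by rewrite (cvg_lim (@ereal_hausdorff R) cvY).
apply: lime_le.
  apply: ereal_nondecreasing_is_cvgn => M M' MM'; apply: le_measure; rewrite ?inE//.
  by have := ndY _ _ MM'; rewrite subsetEset.
by apply: nearW => M; exact: families_upper_bound.
Qed.

End one_history.

End split_tree_upper_bound.

(** * Measurability of the split tree *)

Section countable_valued.
Context d (Om : measurableType d).

(** Measurability for maps into a countable type such as [seq node], with no sigma-algebra on the
    target. *)
Definition measurable_fibers (X : Type) (f : Om -> X) :=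
  forall x, measurable (f @^-1` [set x]).

Lemma measurable_fibers_cst (X : Type) (x : X) : measurable_fibers (fun=> x).
Proof.
move=> y; have [->|xy] := pselect (x = y).
  by rewrite (_ : _ @^-1` _ = setT)//; apply/seteqP; split.
by rewrite (_ : _ @^-1` _ = set0)//; apply/seteqP; split.
Qed.

Lemma measurable_fibers_bind (X : countType) (Y : Type)
    (f : Om -> X) (g : X -> Om -> Y) :
  measurable_fibers f -> (forall x, measurable_fibers (g x)) ->
  measurable_fibers (fun om => g (f om) om).
Proof.
move=> mf mg y.
rewrite (_ : _ @^-1` _ = \bigcup_x (f @^-1` [set x] `&` g x @^-1` [set y])).
  apply: countable_bigcupT_measurable; first exact: countableP.
  by move=> x; apply: measurableI; [exact: mf|exact: mg].
apply/seteqP; split=> om /=; first by move=> gy; exists (f om).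
by move=> [x _ [/= -> ->]].
Qed.

Lemma measurable_fibers_comp (X : countType) (Y : Type) (f : Om -> X) (g : X -> Y) :
  measurable_fibers f -> measurable_fibers (g \o f).
Proof.
move=> mf; apply: (@measurable_fibers_bind X Y f (fun x _ => g x)) => // x.
exact: measurable_fibers_cst.
Qed.

Lemma measurable_fibers_tree (f : Om -> tree) :
  measurable_fibers f -> measurable_fun [set: Om] f.
Proof.
move=> mf _ B _; rewrite setTI.
rewrite (_ : _ @^-1` _ = \bigcup_t if pselect (B t) then f @^-1` [set t] else set0).
  apply: countable_bigcupT_measurable; first exact: countableP.
  by move=> t; case: pselect => Bt; [exact: mf|exact: measurable0].
apply/seteqP; split=> om /=.
  by move=> Bf; exists (f om) => //; case: pselect.
by move=> [t _]; case: pselect => // Bt /= ->.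
Qed.

Variable C : nat * node -> Om -> nat.
Hypothesis mC : forall key, measurable_fibers (C key).

Lemma measurable_ball_position k (t : tree) :
  measurable_fibers (fun om => ball_position (fun v => C (k, v) om) t).
Proof.
rewrite /ball_position; generalize #|` (t : {fset node})|%fset => m.
elim: m => [|m IH] /=.
  exact: measurable_fibers_cst.
apply: (measurable_fibers_bind (g := fun v om =>
  if v \in t then rcons v (C (k, v) om) else v) IH) => v.
case: (v \in t); last exact: measurable_fibers_cst.
by apply: (@measurable_fibers_comp nat node (C (k, v)) (rcons v)).
Qed.

Lemma measurable_full_nodes n :
  measurable_fibers (fun om => full_nodes (fun key => C key om) n).
Proof.
elim: n => [|n IH] /=; first exact: measurable_fibers_cst.
apply: (measurable_fibers_bind (g := fun (t : tree) om =>
  (ball_position (fun v => C (n, v) om) t |` t)%fset : tree) IH) => t.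
exact: (@measurable_fibers_comp node tree _ (fun v => v |` t)%fset
  (measurable_ball_position n t)).
Qed.

Lemma measurable_balls n :
  measurable_fibers (fun om => balls (fun key => C key om) n).
Proof.
elim: n => [|n IH]; first exact: measurable_fibers_cst.
rewrite /balls; under eq_fun do rewrite mkseqS.
apply: (measurable_fibers_bind (g := fun (h : seq node) om =>
  rcons h (ball (fun key => C key om) n)) IH) => h.
apply: (@measurable_fibers_comp node _ _ (rcons h)).
apply: (measurable_fibers_bind (g := fun (t : tree) om =>
  ball_position (fun v => C (n, v) om) t) (measurable_full_nodes n)) => t.
exact: measurable_ball_position.
Qed.

Lemma measurable_split_tree : measurable_fun [set: Om]
  (fun om => split_tree (fun key => C key om) : seq_space tree).
Proof.
apply: measurable_seq_space => n; apply: measurable_fibers_tree.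
exact: measurable_full_nodes.
Qed.

End countable_valued.

Lemma unordered_ext (x y : nat -> tree) n :
  (forall m, (m <= n)%N -> x m = y m) -> unordered x n = unordered y n.
Proof.
move=> xy; rewrite /unordered -xy//; apply/fsetP => v.
have bE u : birth_rank x n u = birth_rank y n u.
  rewrite /birth_rank -xy//; congr (#|` _ |)%fset; apply/fsetP => z.
  rewrite !inE; congr andb; apply: eq_in_has => m.
  by rewrite mem_iota add0n => /= mn; rewrite xy.
have rE u : relabel x n u = relabel y n u by apply: eq_map => k; exact: bE.
by apply/imfsetP/imfsetP => -[u un ->]; exists u; rewrite ?rE.
Qed.

Lemma measurable_unordered :
  measurable_fun [set: seq_space tree] (unordered : seq_space tree -> seq_space tree).
Proof.
apply: measurable_seq_space => n _ B _; rewrite setTI.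
apply: (@measurable_finitely_determined n.+1) => x y xy.
by rewrite /preimage /= (unordered_ext (x := x) (y := y)).
Qed.

Lemma follows_unordered a x : history a -> follows a x ->
  follows (canon a) (unordered x).
Proof. by move=> ha ax m; rewrite size_map => ma; exact: unordered_follows. Qed.

(** * From probabilities of histories to equality of laws *)

Section uniqueness.
Context (R : realType).
Variables m1 m2 : {measure set (seq_space tree) -> \bar R}.

Definition finitely_determined (A : set (seq_space tree)) := exists n,
  forall x y : nat -> tree, (forall m, (m <= n)%N -> x m = y m) -> A x -> A y.

(** The finitely determined events are stable under intersection and generate the sigma-algebra. *)
Lemma eq_finitely_determined : (m1 setT < +oo)%E ->
  (forall A, finitely_determined A -> m1 A = m2 A) -> eq_law m1 m2.
Proof.
move=> m1oo m12 A mA.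
apply: (g_sigma_algebra_measure_unique finitely_determined _ (fun=> setT)) => //.
- by move=> B [n nB]; exact: (@measurable_finitely_determined n.+1).
- by exists 0%N.
- by rewrite bigcup_const.
- move=> B B' [n nB] [n' nB']; exists (maxn n n') => x y xy [Bx B'x]; split.
    by apply: nB Bx => m mn; rewrite xy// leq_max mn.
  by apply: nB' B'x => m mn; rewrite xy// leq_max mn orbT.
move: mA; apply: sub_sigma_algebra2 => B [n _ [D mD <-]].
by exists n => x y xy; rewrite setTI /= xy.
Qed.

End uniqueness.

Section comparison.
Context (R : realType).
Variables m1 m2 : probability (seq_space tree) R.

Let H (w : seq node) : set (seq_space tree) := [set x | follows w x].

(* The bound extends to every event determined by finitely many trees, and hence
   to its complement, which gives the reverse bound. *)
Lemma eq_law_of_history_bounds :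
  (forall n w, w \in canonical_histories n -> (m2 (H w) <= m1 (H w))%E) ->
  (forall n, m2 (\bigcup_(w in [set` canonical_histories n]) H w) = 1%:E) ->
  eq_law m1 m2.
Proof.
move=> m21 m2U; apply: eq_finitely_determined.
  by rewrite [X in (X < _)%E](probability_setT m1) ltry.
have mH n w : w \in canonical_histories n -> measurable (H w).
  move=> wn; apply: (@measurable_finitely_determined n.+1) => x y xy wx.
  by apply: followsW xy _ wx; rewrite (size_canonical wn).
have mA A : finitely_determined A -> measurable A.
  by move=> [n nA]; exact: (@measurable_finitely_determined n.+1).
have le21 A : finitely_determined A -> (m2 A <= m1 A)%E.
  move=> fA; have mA' := mA A fA; have [n nA] := fA.
  pose L := [set` canonical_histories n]; pose U := \bigcup_(w in L) H w.
  have finL : finite_set L by exact: finite_seq.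
  have mAH w : L w -> measurable (A `&` H w).
    by move=> /mH; exact: measurableI.
  have tAH : trivIset L (fun w => A `&` H w).
    move=> w w' wn wn' [x [[_ wx] [_ wx']]].
    have sww : size w = size w' by rewrite (size_canonical wn) (size_canonical wn').
    apply: tset_inj_take => //; rewrite ?history_uniq//.
    - exact: (canonicalP wn).1.
    - exact: (canonicalP wn').1.
    - by move=> m mw; rewrite -wx// wx'// -sww.
  have mU : measurable U by apply: fin_bigcup_measurable => // w; exact: mH.
  (* [m2] gives mass one to the union of the histories, so the part of [A] outside is null; on the
     side of [m1] an inclusion is enough. *)
  have -> : m2 A = m2 (A `&` U).
    rewrite (measureDI m2 mA' mU) [X in (X + _)%E](_ : _ = 0%E) ?add0e//.
    apply/eqP; rewrite -measure_le0; apply: (@le_trans _ _ (m2 (~` U))).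
      by apply: le_measure; rewrite ?inE; [exact: measurableD|exact: measurableC|move=> x []].
    by rewrite probability_setC// [X in (_ - X)%E](m2U n) subee.
  rewrite setI_bigcupr; apply: (@le_trans _ _ (m1 (\bigcup_(w in L) (A `&` H w)))); last first.
    apply: le_measure; rewrite ?inE//; first exact: fin_bigcup_measurable.
    by move=> x [w _ []].
  rewrite !measure_fin_bigcup//; apply: lee_fsum => // w wn.
  (* [A] depends on the trees up to index [n] only, and [w] determines these: [A] contains [H w] or
     misses it. *)
  have [[x [Ax wx]]|AH0] := pselect (A `&` H w !=set0).
    have -> : A `&` H w = H w.
      apply/seteqP; split=> y; first by case.
      move=> wy; split => //; apply: nA Ax => m mn.
      by rewrite wx ?wy// (size_canonical wn) ltnS.
    exact: m21 wn.
  have -> : A `&` H w = set0.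
    by apply/seteqP; split => // y yAH; case: AH0; exists y.
  by rewrite !measure0.
move=> A fA; apply/eqP; rewrite eq_le [X in _ && X]le21// andbT.
have fCA : finitely_determined (~` A).
  have [n nA] := fA; exists n => x y xy nAx Ay; apply: nAx.
  by apply: nA Ay => m mn; rewrite xy.
have := le21 _ fCA; rewrite !probability_setC//; try exact: mA.
have [f1 f2] : m1 A \is a fin_num /\ m2 A \is a fin_num.
  by split; apply: fin_num_measure; exact: mA.
rewrite -(fineK f1) -(fineK f2) -!EFinB !lee_fin lerD2l lerN2 => le12.
suff : (m1 A <= m2 A)%E by [].
by rewrite -(fineK f1) -(fineK f2) lee_fin.
Qed.

End comparison.

Theorem corollary1p7 (R : realType) (mu : probability (seq_space R) R)
  (hmu : is_GEM (2%:R^-1) (2%:R^-1) mu \/ is_PD (2%:R^-1) (2%:R^-1) mu)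
  (d1 : measure_display) (Om1 : measurableType d1) (P1 : probability Om1 R)
  (T : {RV P1 >-> seq_space tree}) (hT : preferential_attachment T)
  (d2 : measure_display) (Om2 : measurableType d2) (P2 : probability Om2 R)
  (V : node -> {RV P2 >-> seq_space R}) (C : nat * node -> {RV P2 >-> nat})
  (hS : split_tree_model mu V C) :
  eq_law
    (pushforward P1 (fun w => unordered (T w) : seq_space tree))
    (pushforward P2
       (fun w => unordered (split_tree (fun k => C k w)) : seq_space tree)).
Proof.
have half01 : 0 <= (2^-1 : R) < 1 by rewrite invr_ge0 ler0n invf_lt1 ?ltr1n.
have half0 : 0 < (2^-1 : R) by rewrite invr_gt0.
have muP M ns : all (fun n => 0 < n)%N ns ->
    (\int[mu]_x (arrangement_sum ns (iota 0 M) x)%:E <=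
     (eppf (2^-1 : R) 2^-1 ns)%:E)%E.
  case: hmu => [/is_GEM_arrangement_sum|/is_PD_arrangement_sum]; exact.
have mC key : measurable_fibers (C key).
  by move=> i; rewrite -[X in measurable X]setTI; exact: measurable_funPT.
have mT : measurable_fun [set: Om1] (fun w => unordered (T w) : seq_space tree).
  exact: measurableT_comp measurable_unordered _.
have mS : measurable_fun [set: Om2]
    (fun w => unordered (split_tree (fun k => C k w)) : seq_space tree).
  exact: (measurableT_comp measurable_unordered (measurable_split_tree mC)).
pose X1 : {RV P1 >-> seq_space tree} := mfun_Sub (mem_set mT).
pose X2 : {RV P2 >-> seq_space tree} := mfun_Sub (mem_set mS).
suff : eq_law (distribution P1 X1) (distribution P2 X2) by [].
(* The balls supply a history of the split tree, so following [w] becomes an equation between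
   canonical histories. *)
have splitE n w om : w \in canonical_histories n ->
    follows w (unordered (split_tree (fun k => C k om))) <->
    canon (balls (fun k => C k om) n.+1) = w.
  move=> wn; set h := balls _ _.
  have hh : history h by exact: history_balls.
  have hx := follows_unordered hh (@follows_balls (fun k => C k om) n.+1).
  have hn : canon h \in canonical_histories n.
    by apply: canon_canonical => //; rewrite size_mkseq.
  split=> [wx|<-//]; apply: tset_inj_take.
  - by apply: history_uniq; exact: (canonicalP hn).1.
  - by apply: history_uniq; exact: (canonicalP wn).1.
  - by rewrite (size_canonical hn) (size_canonical wn).
  - move=> m mh; rewrite -hx// -wx//.
    by rewrite (size_canonical wn) -(size_canonical hn).
apply: eq_law_of_history_bounds => [n w wn|n].
  apply: (@le_trans _ _ (weight R w)%:E).
    rewrite [X in (X <= _)%E](_ : _ =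
      P2 [set om | canon (balls (fun key => C key om) n.+1) = w]); last first.
      by congr (P2 _); apply/seteqP; split=> om /(splitE n w om wn).
    apply: (canonical_history_upper_bound muP hS wn).
    exact: (@measurable_fibers_comp _ _ (seq node) _ _ canon (measurable_balls mC n.+1) w).
  apply: le_trans (preferential_attachment_lower_bound hT wn) _.
  apply: le_measure; rewrite ?inE.
  - rewrite -[X in measurable X]setTI; apply: measurable_funPT => //.
    apply: (@measurable_finitely_determined n.+1) => x y xy [a [ha aw ax]].
    exists a; split => //; apply: followsW xy _ ax.
    by rewrite -(size_map (relab a)) -[map _ _]/(canon a) aw (size_canonical wn).
  - rewrite -[X in measurable X]setTI; apply: (mT) => //.
    apply: (@measurable_finitely_determined n.+1) => x y xy wx.
    by apply: followsW xy _ wx; rewrite (size_canonical wn).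
  move=> om [a [ha <- aT]]; exact: follows_unordered.
(* Every outcome follows the canonical form of its own history of balls. *)
rewrite -(probability_setT P2); congr (P2 _); apply/seteqP; split => // om _.
have wn : canon (balls (fun k => C k om) n.+1) \in canonical_histories n.
  by apply: canon_canonical; [exact: history_balls|rewrite size_mkseq].
exists (canon (balls (fun k => C k om) n.+1)); first exact: wn.
by have [_ E] := splitE n _ om wn; apply: E.
Qed.
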